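(* Let $\Pi:R_\ell\to\mathrm{Hom}(\mathcal H)$ be a US-rep over $\mathfrak g$ at level $\ell$ and let $A$ be a subgroup of $\mathcal W_\ell$. For every $e^H\in T_{\ell,0}$, $$m_A(e^H)=\sum_{e^{H'}\in T_A}m_\Pi(e^{H+H'}).$$ In particular, for $A=\mathcal W_\ell$ (i.e. the full weight lattice $\mathcal W$), $$m_{\mathcal W}(e^H)=m_\Pi(e^H)=m_{\mathcal W}(e^{\theta(H)}),\qquad\forall\,\theta\in W.$$
   Context: Lie theory. $\mathfrak g$ is a simple complex Lie algebra, the complexification of the Lie algebra of a simply connected compact Lie group $K$; $T\subset K$ is a maximal torus with Lie algebra $\mathfrak t$. Fix the invariant inner product $\langle\cdot,\cdot\rangle$, positive definite on $\mathfrak t$, and use it to regard roots and weights as elements of $\mathfrak t$; $r_+$ is the highest root, and the normalization is $\langle r_+,r_+\rangle=2$. Coroots are $H_r=2r/\langle r,r\rangle$. Elements of $T$ are written $e^H$, $H\in\mathfrak t$, where $e^{2\pi H}=1$ iff $H$ lies in the coroot lattice. $W$ is the Weyl group, acting on $\mathfrak t$ and on $T$ by $e^H\mapsto e^{\theta(H)}$; $\varepsilon(\theta)$ is the sign of $\theta\in W$; $\theta_r$ is the reflection in the root $r$. $\mathcal W$ is the weight lattice. $\mathbf W_f$ is the set of fundamental weights, $\rho$ their sum. For a dominant weight $k$, $\chi_k$ is the character of the irreducible representation of $K$ with highest weight $k$, so $\chi_k(e^H)=\sum_s m_k(s)e^{i\langle s,H\rangle}$, the sum over the weights $s$ of the representation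 with multiplicities $m_k(s)$. Level. $\ell\in\mathbb N$, $n_c=c^\vee+\ell$ with $c^\vee$ the dual Coxeter number. $\mathcal R_a=\mathrm{span}_{\mathbb Z}\{\theta(r_+):\theta\in W\}$, $\mathcal W_\ell=\mathcal W/n_c\mathcal R_a$. A subgroup $A$ of $\mathcal W_\ell$ is identified with the corresponding subgroup $n_c\mathcal R_a\subset A\subset\mathcal W$, and $T_A=\{e^{2\pi H}:H\in\mathfrak t,\ \langle r,H\rangle\in\mathbb Z\ \forall r\in A\}$; $T_\ell=T_{n_c\mathcal R_a}$. $T_{\ell,0}$ is the set of $e^H\in T_\ell$ with $e^{\theta_r(H)}\ne e^H$ for every root $r$. $\mathcal C_\ell$ is the set of $k=\sum_w k_w w\in\mathcal W$ ($w\in\mathbf W_f$) with all $k_w>0$ and $\langle k,H_{r_+}\rangle<n_c$. Verlinde ring. For $k\in\mathcal W_\ell$, $\tilde\chi_k$ is the function on $T_{\ell,0}$ given by $\tilde\chi_k(e^H)=\sum_{\theta\in W}\varepsilon(\theta)e^{i\langle\theta(k),H\rangle}$. $R_\ell$ is the fusion ring with $\mathbb Z$-basis $\{\tilde\chi_k\}_{k\in\mathcal C_\ell}$, multiplication $f\star g=fg/\tilde\chi_\rho$, identity $\tilde\chi_\rho$, and involution $\tilde\chi_k^*=\tilde\chi_{k^*}$, $k^*=\Omega(-k)$, where $\Omega\in W$ satisfies $\Omega(\rho)=-\rho$. Representations. A US-rep is a representation $\Pi:R_\ell\to\mathrm{Hom}(\mathcal H)$ on a finite-dimensional Hilbert space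 $\mathcal H$ with $\Pi(\tilde\chi_\rho)=I$ and $\langle\Pi(\tilde\chi_j)v,v'\rangle=\langle v,\Pi(\tilde\chi_j^* )v'\rangle$. Write $\Pi_w=\Pi(\tilde\chi_{w+\rho})$, $w\in\mathbf W_f$. For $e^H\in T_\ell$, $m_\Pi(e^H)=\dim\{v\in\mathcal H:\Pi_wv=\chi_w(e^H)v\ \forall w\in\mathbf W_f\}$. Quantum root space. $L^2(\mathcal W_\ell)$ has basis of delta functions $\delta_k$, $k\in\mathcal W_\ell$. For $w\in\mathbf W_f$, $\Delta_w\delta_k=\sum_s m_w(s)\delta_{k+s}$ (sum over the weights $s$ of the irreducible representation of highest weight $w$). The full quantum root space is $\mathcal R_\Pi=\{f\in L^2(\mathcal W_\ell)\otimes\mathcal H:(\Delta_w\otimes I-I\otimes\Pi_w)f=0\ \forall w\in\mathbf W_f\}$. Translations: $\vartheta_j\delta_k=\delta_{k-j}$ on $L^2(\mathcal W_\ell)$, $\tilde\vartheta_j=\vartheta_j\otimes I$, which preserves $\mathcal R_\Pi$. For $e^H\in T_{\ell,0}$, $m_A(e^H)=\dim\{f\in\mathcal R_\Pi:\tilde\vartheta_jf=e^{-i\langle j,H\rangle}f\ \forall j\in A\}$. *)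

(* Defs.v *)
From HB Require Import structures.
From mathcomp Require Import all_boot all_order all_algebra.
From mathcomp Require Import generic_quotient ring_quotient sesquilinear.
From mathcomp Require Import complex.
From mathcomp Require Import all_classical all_reals all_analysis.

Set Implicit Arguments.
Unset Strict Implicit.
Unset Printing Implicit Defensive.

Import Order.TTheory GRing.Theory Num.Theory.

Local Open Scope classical_set_scope.
Local Open Scope ring_scope.
Local Open Scope complex_scope.
Local Open Scope quotient_scope.

Definition cis (R : realType) (a : R) : R[i] := cos a +i* sin a.

Definition is_subgroup (V : zmodType) (G : set V) : Prop :=
  G 0 /\ forall x y, G x -> G y -> G (x - y).

Definition zspan (V : zmodType) (S : set V) : set V :=
  [set x | forall G : set V, is_subgroup G -> S `<=` G -> G x].

Lemma zspan_subgroup (V : zmodType) (S : set V) : is_subgroup (zspan S).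
Proof.
split=> [G [] //|x y Sx Sy G Gs SG].
by apply: Gs.2; [exact: Sx | exact: Sy].
Qed.

(* The dimension of a linear subspace [U] of a possibly infinite-dimensional
   space; it is 0 by convention when [U] has no finite basis. *)
Definition is_basis (F : fieldType) (E : lmodType F) (U : set E) (n : nat)
    (b : 'I_n -> E) : Prop :=
  (forall i, U (b i)) /\
  (forall v, U v -> exists! c : 'rV[F]_n, v = \sum_i c 0 i *: b i).

Definition fdim (F : fieldType) (E : lmodType F) (U : set E) : nat :=
  xget 0%N [set n : nat | exists b : 'I_n -> E, is_basis U b].

Record lieAlg (F : fieldType) := LieAlg {
  lie_space :> vectType F;
  lie_br : {bilinear lie_space -> lie_space -> lie_space};
  lie_br_alt : forall x, lie_br x x = 0;
  lie_jacobi : forall x y z,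
    lie_br x (lie_br y z) + lie_br y (lie_br z x) + lie_br z (lie_br x y) = 0
}.
Arguments lie_br {F l}.

Definition is_simple (F : fieldType) (g : lieAlg F) : Prop :=
  (exists x y : g, lie_br x y != 0) /\
  (forall I : {vspace g}, (forall x y, y \in I -> lie_br x y \in I) ->
     I = 0%VS \/ I = fullv).

Record lieRep (F : fieldType) (g : lieAlg F) := LieRep {
  rep_space :> vectType F;
  rep_map : {linear g -> 'End(rep_space)};
  rep_map_br : forall x y, rep_map (lie_br x y) =
    (rep_map x \o rep_map y)%VF - (rep_map y \o rep_map x)%VF
}.

Definition is_irreducible (F : fieldType) (g : lieAlg F) (V : lieRep g) : Prop :=
  (exists v : V, v != 0) /\
  (forall U : {vspace V}, (forall x v, v \in U -> rep_map V x v \in U) ->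
     U = 0%VS \/ U = fullv).

Section TrivialRep.
Variables (F : fieldType) (g : lieAlg F).

Fact trivial_rep_br (x y : g) :
  (\0 : {linear g -> 'End(F^o)}) (lie_br x y) =
  ((\0 : {linear g -> 'End(F^o)}) x \o (\0 : {linear g -> 'End(F^o)}) y)%VF -
  ((\0 : {linear g -> 'End(F^o)}) y \o (\0 : {linear g -> 'End(F^o)}) x)%VF.
Proof. by rewrite /= subrr. Qed.

Definition trivial_rep : lieRep g := LieRep trivial_rep_br.

End TrivialRep.

(* [cpt] is the Lie algebra of the simply connected compact group K: being the
   Lie algebra of a compact group is expressed by the existence of an invariant
   inner product.  [cplx] is its complexification g, and [torus] is the Lie
   algebra t of a maximal torus, i.e. a maximal abelian subalgebra of [cpt]. *)
Record compactDatum (R : realType) := CompactDatum {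
  cpt : lieAlg R;
  cplx : lieAlg R[i];
  incl : cpt -> cplx;
  incl_linear : forall a x y, incl (a *: x + y) = a%:C *: incl x + incl y;
  incl_br : forall x y, incl (lie_br x y) = lie_br (incl x) (incl y);
  incl_cplx : forall z, exists! p : cpt * cpt,
    z = incl p.1 + (0 +i* 1) *: incl p.2;
  cplx_simple : is_simple cplx;
  inner : {dot cpt for idfun};
  inner_invariant : forall x y z,
    inner (lie_br x y) z = inner x (lie_br y z);
  torus : {vspace cpt};
  torus_max_abelian : forall x,
    x \in torus <-> (forall y, y \in torus -> lie_br x y = 0)
}.

Section Roots.
Variables (R : realType) (K : compactDatum R).

Definition tor : vectType R := subvs_of (torus K).

Definition dot (x y : tor) : R := inner K (vsval x) (vsval y).

(* Weights are elements of t: the weight [s] stands for the character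
   e^H |-> e^(i <s, H>) of the torus. *)
Definition weight_vector (V : lieRep (cplx K)) (s : tor) : set V :=
  [set v | forall H : tor, rep_map V (incl (vsval H)) v = (0 +i* dot s H) *: v].

Definition has_weight (V : lieRep (cplx K)) (s : tor) : Prop :=
  exists2 v, weight_vector (V := V) s v & v != 0.

Definition is_root (r : tor) : Prop :=
  r != 0 /\ exists2 x : cplx K, x != 0 &
    forall H : tor, lie_br (incl (vsval H)) x = (0 +i* dot r H) *: x.

Definition coroot (r : tor) : tor := (2 / dot r r) *: r.

Definition refl (r : tor) : 'End(tor) :=
  linfun (fun H : tor => H - dot r H *: coroot r).

Inductive weyl : 'End(tor) -> Prop :=
| weyl_id : weyl \1%VF
| weyl_refl r th : is_root r -> weyl th -> weyl (refl r \o th)%VF.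

Definition weyl_sign (th : 'End(tor)) : R :=
  \det (passmx.mxof (vbasis {:tor}) (vbasis {:tor}) th).

Definition nat_comb (b : seq tor) (x : tor) : Prop :=
  exists c : tor -> nat, x = \sum_(a <- b) a *+ c a.

Definition is_base (b : seq tor) : Prop :=
  [/\ free b,
      forall a, a \in b -> is_root a
    & forall r, is_root r -> nat_comb b r \/ nat_comb b (- r)].

Definition is_highest_root (b : seq tor) (r : tor) : Prop :=
  is_root r /\ forall r', is_root r' -> nat_comb b (r - r').

Definition is_highest_weight (b : seq tor) (V : lieRep (cplx K)) (k : tor) :=
  has_weight V k /\ forall s, has_weight V s -> nat_comb b (k - s).

End Roots.

Record simpleDatum (R : realType) := SimpleDatum {
  compact_datum :> compactDatum R;
  base : seq (tor compact_datum);
  base_is_base : is_base base;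
  rplus : tor compact_datum;
  rplus_highest : is_highest_root base rplus;
  rplus_norm : dot rplus rplus = 2
}.

Section Lattices.
Variables (R : realType) (g : simpleDatum R).
Local Notation t := (tor g).

Definition in_weight_lattice : {pred t} := fun k =>
  `[< forall r, is_root r -> dot k (coroot r) \is a Num.int >].

Fact in_weight_lattice_zmod_closed : zmod_closed in_weight_lattice.
Proof.
split=> [|x y /asboolP hx /asboolP hy]; apply/asboolP => r hr.
  by rewrite /dot !linear0l rpred0.
rewrite /dot linearB linearBl.
by apply: rpredB; [exact: hx | exact: hy].
Qed.

HB.instance Definition _ :=
  GRing.isZmodClosed.Build t in_weight_lattice in_weight_lattice_zmod_closed.

Record weight := Weight { wval : t; wvalP : wval \in in_weight_lattice }.

HB.instance Definition _ := [isSub for wval].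
HB.instance Definition _ := [Choice of weight by <:].
HB.instance Definition _ := [SubChoice_isSubZmodule of weight by <:].

(* 2 pi times the coroot lattice, i.e. the kernel of H |-> e^H. *)
Definition exp_kernel : {pred t} := fun H =>
  `[< exists2 x, zspan [set coroot r | r in @is_root R g] x
               & H = (2 * pi) *: x >].

Fact exp_kernel_zmod_closed : zmod_closed exp_kernel.
Proof.
have [z0 zB] := zspan_subgroup [set coroot r | r in @is_root R g].
split=> [|_ _ /asboolP[x hx ->] /asboolP[y hy ->]]; apply/asboolP.
  by exists 0; rewrite ?scaler0.
by exists (x - y); rewrite ?scalerBr //; exact: zB.
Qed.

HB.instance Definition _ :=
  GRing.isZmodClosed.Build t exp_kernel exp_kernel_zmod_closed.

(* The maximal torus T, written additively. *)
Definition T : zmodType := Quotient.quot (exp_kernel : zmodClosed t).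

Definition expT (H : t) : T := \pi_T H.

Definition fundamental : set weight :=
  [set w | exists2 a0, a0 \in base g &
     forall a, a \in base g -> dot (wval w) (coroot a) = (a == a0)%:R].

Definition rho : weight := \sum_(w \in fundamental) w.

Definition is_irrep (k : weight) (V : lieRep (cplx g)) : Prop :=
  is_irreducible V /\ is_highest_weight (base g) V (wval k).

(* The irreducible representation of highest weight k; the default value is
   never used when k is dominant. *)
Definition irrep (k : weight) : lieRep (cplx g) :=
  if pselect (exists V, is_irrep k V) is left ex then projT1 (cid ex)
  else trivial_rep (cplx g).

Definition mult (k s : weight) : nat :=
  fdim (@weight_vector R g (irrep k) (wval s)).

(* The weights of a finite-dimensional representation lie in the weight
   lattice and there are finitely many of them.  As they take integral values
   on coroots, the choice of a representative of [x] is irrelevant. *)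
Definition chi (k : weight) (x : T) : R[i] :=
  \sum_(s \in [set: weight]) (mult k s)%:R * cis (dot (wval s) (repr x)).

Variable l : nat.

(* The dual Coxeter number is 1 + <rho, H_{r_+}>. *)
Definition dual_coxeter : R := 1 + dot (wval rho) (coroot (rplus g)).

Definition nc : R := dual_coxeter + l%:R.

Definition Ra : set t := zspan [set th (rplus g) | th in @weyl R g].

Definition in_nc_Ra : {pred weight} := fun k =>
  `[< exists2 a, Ra a & wval k = nc *: a >].

Fact in_nc_Ra_zmod_closed : zmod_closed in_nc_Ra.
Proof.
have [z0 zB] : is_subgroup Ra by exact: zspan_subgroup.
split=> [|x y /asboolP[a ha hx] /asboolP[b hb hy]]; apply/asboolP.
  by exists 0; rewrite ?scaler0.
by exists (a - b); [exact: zB | rewrite /= scalerBr -hx -hy].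
Qed.

HB.instance Definition _ :=
  GRing.isZmodClosed.Build weight in_nc_Ra in_nc_Ra_zmod_closed.

Definition Wl : zmodType := Quotient.quot (in_nc_Ra : zmodClosed weight).

Definition piW (k : weight) : Wl := \pi_Wl k.

Definition TA (A : set Wl) : set T :=
  [set expT ((2 * pi) *: H) | H in
     [set H : t | forall r, A (piW r) -> dot (wval r) H \is a Num.int]].

Definition Tl : set T := TA [set 0].

Definition Tl0 : set T := [set x | Tl x /\
  forall H r, x = expT H -> is_root r -> expT (refl r H) <> x].

Definition alcove : set weight := [set k |
  (exists2 c : weight -> nat, (forall w, fundamental w -> (0 < c w)%N)
     & k = \sum_(w \in fundamental) w *+ c w) /\
  dot (wval k) (coroot (rplus g)) < nc].

(* On [Tl0] this depends only on the class of k modulo n_c R_a, and not on the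
   representative of x. *)
Definition chit (k : weight) : Tl0 -> R[i] := fun x =>
  \sum_(th \in @weyl R g)
     (weyl_sign th)%:C * cis (dot (th (wval k)) (repr (val x))).

Definition fusion (f h : Tl0 -> R[i]) : Tl0 -> R[i] :=
  fun x => f x * h x / chit rho x.

Definition Rl : set (Tl0 -> R[i]) := zspan [set chit k | k in alcove].

(* k' = k^*, where Omega is the element of W such that Omega (rho) = - rho. *)
Definition is_dual_weight (k k' : weight) : Prop :=
  exists Omega, [/\ weyl Omega, Omega (wval rho) = - wval rho
                  & wval k' = Omega (- wval k)].

(* Only the values of [Pi] on [Rl] matter. *)
Record is_USrep (Hs : vectType R[i]) (ip : {dot Hs for (@Num.conj R[i])})
    (Pi : (Tl0 -> R[i]) -> 'End(Hs)) : Prop := IsUSrep {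
  USrepB : forall f h, Rl f -> Rl h -> Pi (f - h) = Pi f - Pi h;
  USrepM : forall f h, Rl f -> Rl h -> Pi (fusion f h) = (Pi f \o Pi h)%VF;
  USrep1 : Pi (chit rho) = \1%VF;
  USrep_adj : forall j j', alcove j -> is_dual_weight j j' ->
    forall v v', ip (Pi (chit j) v) v' = ip v (Pi (chit j') v')
}.

Section QuantumRootSpace.
Variables (Hs : vectType R[i]) (Pi : (Tl0 -> R[i]) -> 'End(Hs)).

Definition Pi_fund (w : weight) : 'End(Hs) := Pi (chit (w + rho)).

Definition mPi (x : T) : nat :=
  fdim [set v : Hs | forall w, fundamental w -> Pi_fund w v = chi w x *: v].

(* L^2(W_l) (x) Hs is the space of functions W_l -> Hs, the pure tensor
   delta_k (x) v being the function equal to v at k and to 0 elsewhere.  So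
   delta_k |-> delta_(k + s) is f |-> (k |-> f (k - s)), and
   delta_k |-> delta_(k - j) is f |-> (k |-> f (k + j)). *)
Definition Delta (w : weight) (f : Wl -> Hs) : Wl -> Hs :=
  fun k => \sum_(s \in [set: weight]) (mult w s)%:R *: f (k - piW s).

Definition translation (j : Wl) (f : Wl -> Hs) : Wl -> Hs :=
  fun k => f (k + j).

Definition root_space : set (Wl -> Hs) :=
  [set f | forall w, fundamental w -> forall k, Delta w f k - Pi_fund w (f k) = 0].

(* Multiplicities are attached to elements of T_l; there the phases do not
   depend on the representative of x. *)
Definition mA (A : set Wl) (x : T) : nat :=
  fdim [set f : Wl -> Hs | root_space f /\
    forall j, A (piW j) ->
      translation (piW j) f = cis (- dot (wval j) (repr x)) *: f].

End QuantumRootSpace.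

End Lattices.

Arguments Tl0 {R} g l _.
Arguments Wl {R} g l.

(* Main.v *)
(* Fourier analysis on the finite group W_l: a function in the A-eigenspace of
   e^H is a sum of joint eigenvectors of all translations, each of which is a
   plane wave k |-> e^(-i<k,y>) v with y in T_l.  The operator Delta_w multiplies
   that wave by chi_w(y), so it lies in the root space iff v is a joint
   eigenvector of the Pi_w with eigenvalues chi_w(y), and it has the right
   A-eigenvalues iff y is in e^H T_A.  For A = W_l the group T_A is trivial, the
   coroot lattice being its own double dual.

   What it needs of the root system comes from the compact form: root vectors
   e = x + iy generate sl2-triples with f proportional to x - iy, which gives
   the integrality of weights on coroots and, through the injectivity of f^m
   on the weight space of a weight taking the value m >= 0 on the coroot, the
   Weyl invariance of multiplicities, hence of chi_w; simplicity gives that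
   the roots span t; and the highest root forces its Weyl orbit to span t, so
   that W_l and T_l are finite. *)
Require Import Defs.
From HB Require Import structures.
From mathcomp Require Import all_boot all_order all_algebra.
From mathcomp Require Import generic_quotient ring_quotient sesquilinear complex.
From mathcomp Require Import all_classical all_reals all_analysis.
From mathcomp Require Import ring lra.

Set Implicit Arguments.
Unset Strict Implicit.
Unset Printing Implicit Defensive.

Import Order.TTheory GRing.Theory Num.Theory.

Local Open Scope classical_set_scope.
Local Open Scope ring_scope.

Local Notation incl := Defs.incl.

(** * Linear algebra *)

(** [fdim] is pinned down only by exhibiting a basis, so the A-eigenspace receives an explicit one:
    for each z in T_A, the waves at x + z with coefficients in a basis of the joint eigenspace of
    the [Pi_w] there. Freeness is the separation of points of T by weights; spanning is Fourier
    inversion. The inversion never sums over W_l. It uses an exponent N such that N times any weight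
    lies in n_c R_a: each translation then has order dividing N, and its spectral projections are
    averages over N-th roots of unity. Being polynomials in that translation, they preserve every
    stable subspace, so they can be applied for one generator of the weight lattice after another
    without leaving the A-eigenspace. Coordinates on both sides come from a basis of the coroot
    lattice and its dual basis of weights. Coroots are only known as a finite generating set, so
    this basis is extracted by Smith normal form, once integrality of roots on coroots is available
    from the adjoint representation. *)

Section LinearSubsets.
Variables (F : fieldType) (E : lmodType F).
Implicit Types U : set E.

(** Subspaces are predicates because the functions on W_l form an [lmodType] with no
    finite-dimensional structure attached. *)
Definition lin_closed U := U 0 /\ forall a x y, U x -> U y -> U (a *: x + y).

Lemma lin_closedZ U a x : lin_closed U -> U x -> U (a *: x).
Proof. by case=> U0 UL Ux; rewrite -[_ *: _]addr0; exact: UL. Qed.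

Lemma lin_closedD U x y : lin_closed U -> U x -> U y -> U (x + y).
Proof. by case=> U0 UL Ux Uy; rewrite -[x]scale1r; exact: UL. Qed.

Lemma lin_closed_sum U (I : Type) (r : seq I) (P : pred I) (f : I -> E) :
  lin_closed U -> (forall i, P i -> U (f i)) -> U (\sum_(i <- r | P i) f i).
Proof.
by move=> UL Uf; elim/big_ind: _ => //; [exact: UL.1 | move=> x y; exact: lin_closedD].
Qed.

(** By uniqueness of coordinates the two change-of-basis matrices multiply to the identity of size
    m; factoring it through size n forces m <= n. *)
Lemma leq_is_basis U m n (b : 'I_m -> E) (b' : 'I_n -> E) :
  is_basis U b -> is_basis U b' -> (m <= n)%N.
Proof.
move=> [Ub bU] [Ub' b'U].
have /choice[M hM] i : exists c : 'rV[F]_n, b i = \sum_j c 0 j *: b' j.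
  by have [c [hc _]] := b'U _ (Ub i); exists c.
have /choice[N hN] i : exists c : 'rV[F]_m, b' i = \sum_j c 0 j *: b j.
  by have [c [hc _]] := bU _ (Ub' i); exists c.
apply: (@mulmx1_min F m n (\matrix_i M i) (\matrix_i N i)).
apply/row_matrixP => i; have [c [_ hc]] := bU _ (Ub i).
transitivity c; [symmetry|]; apply: hc.
  rewrite hM; under eq_bigr do rewrite hN scaler_sumr.
  rewrite exchange_big /=; apply: eq_bigr => k _.
  under eq_bigr do rewrite scalerA.
  rewrite -scaler_suml; congr (_ *: _); rewrite !mxE.
  by apply: eq_bigr => j _; rewrite !mxE.
rewrite (bigD1 i) //= !mxE eqxx scale1r big1 ?addr0 // => j ji.
by rewrite !mxE eq_sym (negbTE ji) scale0r.
Qed.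

Lemma fdim_basis U n (b : 'I_n -> E) : is_basis U b -> fdim U = n.
Proof.
move=> Ub; apply: xget_unique; first by exists b.
move=> m [b' Ub'].
by apply/eqP; rewrite eqn_leq (leq_is_basis Ub' Ub) (leq_is_basis Ub Ub').
Qed.

(** A finite index type in place of an ordinal allows the final basis to be indexed by dependent
    pairs. *)
Lemma fdim_family U (J : finType) (b : J -> E) :
  (forall j, U (b j)) ->
  (forall v, U v -> exists c : J -> F, v = \sum_j c j *: b j) ->
  (forall c : J -> F, \sum_j c j *: b j = 0 -> forall j, c j = 0) ->
  fdim U = #|J|.
Proof.
move=> Ub spanb freeb; pose r (i : 'I_#|J|) : J := enum_val i.
have sumE (c : J -> F) : \sum_j c j *: b j = \sum_i c (r i) *: b (r i).
  rewrite (reindex r) //; apply: onW_bij; exact: enum_val_bij.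
apply: (@fdim_basis U #|J| (b \o r)); split=> [i|v Uv]; first exact: Ub.
have [c vE] := spanb _ Uv; exists (\row_i c (r i)); split.
  by rewrite vE sumE; apply: eq_bigr => i _; rewrite mxE.
move=> d dE; apply/rowP => i; rewrite mxE.
have /(_ _ (r i))/= := freeb (fun j => c j - d 0 (enum_rank j)).
rewrite /r enum_valK => /(_ _)/eqP; rewrite subr_eq0 => h; apply/eqP/h.
under eq_bigr do rewrite scalerBl.
rewrite sumrB -vE dE (sumE (fun j => d 0 (enum_rank j))).
by apply/eqP; rewrite subr_eq0; apply/eqP/eq_bigr => k _; rewrite enum_valK.
Qed.

End LinearSubsets.

Section LinearFun.
Variables (F : fieldType) (E E' : lmodType F) (f : E -> E').
Hypothesis f_lin : linear f.

Lemma linear_funD x y : f (x + y) = f x + f y.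
Proof. by have := f_lin 1 x y; rewrite !scale1r. Qed.

Lemma linear_fun0 : f 0 = 0.
Proof. by apply: (addrI (f 0)); rewrite -linear_funD !addr0. Qed.

Lemma linear_funZ a x : f (a *: x) = a *: f x.
Proof. by have := f_lin a x 0; rewrite linear_fun0 !addr0. Qed.

Lemma linear_funsum (J : Type) (r : seq J) (P : pred J) (u : J -> E) :
  f (\sum_(j <- r | P j) u j) = \sum_(j <- r | P j) f (u j).
Proof.
by elim/big_rec2: _ => [|j y1 y2 _ <-]; rewrite ?linear_fun0 ?linear_funD.
Qed.

End LinearFun.

Section Eigenvectors.
Variables (F : fieldType) (E : lmodType F) (I : Type) (S : eqType).
Variables (T : I -> E -> E) (c : S -> I -> F).
Hypothesis T_lin : forall h, linear (T h).
Hypothesis c_sep : forall s s', s <> s' -> exists h, c s h <> c s' h.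

(** [T h - c s0 h] kills the head of the sum and rescales the other terms. A separating h is chosen
    for each s, so no single operator has to distinguish all labels. *)
Lemma eigen_sum_eq0 (u : S -> E) (r : seq S) : uniq r ->
  (forall s, s \in r -> forall h, T h (u s) = c s h *: u s) ->
  \sum_(s <- r) u s = 0 -> forall s, s \in r -> u s = 0.
Proof.
elim: r u => [//|s0 r IHr] u /= /andP[s0r ur] Tu sum0.
have usr s : s \in r -> u s = 0.
  move=> sr; have ss0 : s <> s0 by move=> e; rewrite -e sr in s0r.
  have [h /eqP csh] := c_sep ss0.
  suff /eqP : (c s h - c s0 h) *: u s = 0.
    by rewrite scaler_eq0 subr_eq0 (negbTE csh) => /eqP.
  apply: (IHr (fun s => (c s h - c s0 h) *: u s) ur _ _ s sr).
  - move=> s' s'r h'; rewrite (linear_funZ (T_lin h')) Tu ?inE ?s'r ?orbT //.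
    by rewrite !scalerA mulrC.
  - move: (congr1 (fun x => T h x - c s0 h *: x) sum0) => /=.
    rewrite (linear_fun0 (T_lin h)) scaler0 subrr big_cons (linear_funD (T_lin h)) scalerDr opprD addrACA.
    rewrite Tu ?mem_head // subrr add0r => h0; rewrite -[RHS]h0.
    rewrite scaler_sumr -sumrN.
    rewrite (linear_funsum (T_lin h)).
    rewrite -big_split /= big_seq [RHS]big_seq; apply: eq_bigr => i ir.
    by rewrite scalerBl Tu // inE ir orbT.
move=> s; rewrite inE => /orP[/eqP->|/usr//].
by move: sum0; rewrite big_cons big_seq big1 ?addr0.
Qed.

End Eigenvectors.

Section Vect.
Variables (F : fieldType) (E : vectType F).

Lemma size_free_le (X : seq E) : free X -> (size X <= \dim {:E})%N.
Proof. by rewrite /free => /eqP <-; exact/dimvS/subvf. Qed.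

(** Eigenvectors with distinct labels are independent, so there are at most dim E labels. This
    bounds the set of weights of a representation. *)
Lemma eigen_labels_finite (I : Type) (S : choiceType) (T : I -> E -> E)
    (c : S -> I -> F) :
  (forall h, linear (T h)) ->
  (forall s s', s <> s' -> exists h, c s h <> c s' h) ->
  finite_set [set s | exists2 v, (forall h, T h v = c s h *: v) & v != 0].
Proof.
move=> T_lin c_sep; apply: contrapT => /infinite_set_fset.
move=> /(_ (\dim {:E}).+1)[B BS].
set r := finmap.enum_fset B; have ur : uniq r by exact: finmap.fset_uniq.
have /choice[u hu] s : exists u, s \in r -> (forall h, T h u = c s h *: u) /\ u != 0.
  have [sr|sr] := boolP (s \in r); last by exists 0.
  by have [v] := BS s sr; exists v.
apply/negP; rewrite -ltnNge ltnS -(size_map u).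
apply: size_free_le; change (free (in_tuple (map u r))); apply/freeP => k sum0 i.
have s0 : S by move: i; rewrite size_map; case: (r) => [[]|s0].
have sz : size (map u r) = size r by rewrite size_map.
(* [freeP] indexes coefficients by positions in the list, [eigen_sum_eq0] by labels; [a] translates,
   and its default is not reached for s in r. *)
pose a s := if insub (index s r) is Some j then k j else 0.
have nr (j : 'I_(size (map u r))) : nth s0 r j \in r by rewrite mem_nth -?sz.
have aE (j : 'I_(size (map u r))) : a (nth s0 r j) = k j.
  by rewrite /a index_uniq -?sz // valK.
have : a (nth s0 r i) *: u (nth s0 r i) = 0.
  apply: (eigen_sum_eq0 T_lin c_sep (u := fun s => a s *: u s) ur) => //.
    move=> s sr h.
    by rewrite (linear_funZ (T_lin h)) (hu _ sr).1 !scalerA mulrC.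
  rewrite -[RHS]sum0 (big_nth s0) -sz big_mkord; apply: eq_bigr => j _.
  by rewrite aE (nth_map s0) -?sz.
by rewrite aE; move/eqP; rewrite scaler_eq0 (negbTE (hu _ (nr i)).2) orbF => /eqP.
Qed.

(** A vector space of largest dimension inside U exhausts U, since adjoining another vector of U
    would enlarge it. *)
Lemma lin_closed_vspace (U : set E) :
  lin_closed U -> exists V : {vspace E}, forall v, U v <-> v \in V.
Proof.
move=> UL; pose P n := `[< exists V : {vspace E}, (forall v, v \in V -> U v) /\ \dim V = n >].
have exP : exists n, P n.
  exists 0%N; apply/asboolP; exists 0%VS; split; last by rewrite dimv0.
  by move=> v; rewrite memv0 => /eqP->; exact: UL.1.
have leP n : P n -> (n <= \dim {:E})%N.
  by move=> /asboolP[V [_ <-]]; exact/dimvS/subvf.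
case: (ex_maxnP exP leP) => n /asboolP[V [VU dV]] nmax.
exists V => v; split=> [Uv|/VU//].
have : P (\dim (V + <[v]>)).
  apply/asboolP; exists (V + <[v]>)%VS; split=> // w /memv_addP[x xV [y /vlineP[a ->] ->]].
  by rewrite addrC; apply: UL.2 => //; exact: VU.
move=> /nmax; rewrite -dV => le1.
have /eqP-> : (V == V + <[v]>)%VS by rewrite eqEdim addvSl le1.
by apply: (subvP (addvSr V _)); exact: memv_line.
Qed.

Lemma fdim_vspace (U : set E) (V : {vspace E}) :
  (forall v, U v <-> v \in V) -> fdim U = \dim V.
Proof.
move=> UV; rewrite -[RHS]card_ord.
apply: (@fdim_family _ _ _ _ (fun i : 'I_(\dim V) => (vbasis V)`_i)).
- by move=> i; apply/UV/vbasis_mem; rewrite mem_nth // size_tuple.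
- move=> v /UV vV; exists (fun i => coord (vbasis V) i v); exact: coord_vbasis.
- by apply/freeP; exact: basis_free (vbasisP V).
Qed.

End Vect.

(** * The torus and the complexification *)

Section LieAlgebra.
Variables (F : fieldType) (g : lieAlg F).

Lemma lie_brN (x y : g) : lie_br y x = - lie_br x y.
Proof.
apply/eqP; rewrite -addr_eq0; apply/eqP; rewrite -[RHS](lie_br_alt (x + y)).
by rewrite linearDl !linearD /= !lie_br_alt add0r addr0 addrC.
Qed.

Lemma lie_brDl (x y z : g) : lie_br (x + y) z = lie_br x z + lie_br y z.
Proof. by rewrite linearDl. Qed.

Lemma lie_brDr (x y z : g) : lie_br z (x + y) = lie_br z x + lie_br z y.
Proof. by rewrite linearD. Qed.

Lemma lie_brZl a (x y : g) : lie_br (a *: x) y = a *: lie_br x y.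
Proof. by rewrite linearZl_LR. Qed.

Lemma lie_brZr a (x y : g) : lie_br x (a *: y) = a *: lie_br x y.
Proof. by rewrite linearZr_LR. Qed.

Lemma lie_brNr (x y : g) : lie_br x (- y) = - lie_br x y.
Proof. by rewrite linearN. Qed.

Lemma lie_br0r (x : g) : lie_br x 0 = 0.
Proof. by rewrite linear0. Qed.

Lemma lie_br0l (x : g) : lie_br 0 x = 0.
Proof. by rewrite linear0l. Qed.

Definition ad (x : g) : 'End(g) := linfun (lie_br x : {linear g -> g}).

Lemma adE x y : ad x y = lie_br x y.
Proof. by rewrite lfunE. Qed.

Fact ad_is_linear : linear ad.
Proof.
move=> a x y; apply/lfunP => z.
by rewrite add_lfunE scale_lfunE !adE linearPl.
Qed.

HB.instance Definition _ := GRing.isLinear.Build F g 'End(g) *:%R ad ad_is_linear.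

Lemma ad_br (x y : g) : ad (lie_br x y) = (ad x \o ad y)%VF - (ad y \o ad x)%VF.
Proof.
apply/lfunP => z; rewrite add_lfunE opp_lfunE !comp_lfunE !adE.
have := lie_jacobi x y z; rewrite (lie_brN x z) linearN /=.
rewrite (lie_brN (lie_br x y) z) => /eqP.
by rewrite addr_eq0 opprK => /eqP <-.
Qed.

Definition adjoint : lieRep g := @LieRep F g g ad ad_br.

End LieAlgebra.

Section Torus.
Variables (R : realType) (K : compactDatum R).
Implicit Types (x y z r s H : tor K).
Local Notation t := (tor K).
Local Notation I := (0 +i* 1 : R[i])%C.

Lemma dotC x y : dot x y = dot y x.
Proof. by rewrite /dot hermC /= expr0 mul1r. Qed.

Lemma dotDl x y z : dot (x + y) z = dot x z + dot y z.
Proof. by rewrite /dot linearD linearDl. Qed.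

Lemma dotZl a x z : dot (a *: x) z = a * dot x z.
Proof. by rewrite /dot linearZ linearZl_LR. Qed.

Lemma dotNl x z : dot (- x) z = - dot x z.
Proof. by rewrite -scaleN1r dotZl mulN1r. Qed.

Lemma dotBl x y z : dot (x - y) z = dot x z - dot y z.
Proof. by rewrite dotDl dotNl. Qed.

Lemma dotDr x y z : dot z (x + y) = dot z x + dot z y.
Proof. by rewrite !(dotC z) dotDl. Qed.

Lemma dotZr a x z : dot z (a *: x) = a * dot z x.
Proof. by rewrite !(dotC z) dotZl. Qed.

Lemma dotNr x z : dot z (- x) = - dot z x.
Proof. by rewrite !(dotC z) dotNl. Qed.

Lemma dotBr x y z : dot z (x - y) = dot z x - dot z y.
Proof. by rewrite !(dotC z) dotBl. Qed.

Lemma dot0l x : dot 0 x = 0.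
Proof. by rewrite -(scale0r 0) dotZl mul0r. Qed.

Lemma dot0r x : dot x 0 = 0.
Proof. by rewrite dotC dot0l. Qed.

Lemma dot_suml (J : Type) (q : seq J) (P : pred J) (u : J -> t) x :
  dot (\sum_(j <- q | P j) u j) x = \sum_(j <- q | P j) dot (u j) x.
Proof. by elim/big_rec2: _ => [|j y1 y2 _ <-]; rewrite ?dot0l ?dotDl. Qed.

Lemma dot_sumr (J : Type) (q : seq J) (P : pred J) (u : J -> t) x :
  dot x (\sum_(j <- q | P j) u j) = \sum_(j <- q | P j) dot x (u j).
Proof. by rewrite dotC dot_suml; apply: eq_bigr => j _; rewrite dotC. Qed.

Lemma dot_gt0 x : x != 0 -> 0 < dot x x.
Proof. by rewrite -(inj_eq val_inj); exact: neq0_dnorm_gt0. Qed.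

Lemma dot_eq0 x : dot x x = 0 -> x = 0.
Proof. by move=> h; apply/eqP; apply: contraT => /dot_gt0; rewrite h ltxx. Qed.

Lemma dot_ext x y : (forall H, dot x H = dot y H) -> x = y.
Proof.
move=> xy; apply/eqP; rewrite -subr_eq0; apply/eqP/dot_eq0.
by rewrite dotBl xy subrr.
Qed.

Lemma reflE r H : refl r H = H - dot r H *: coroot r.
Proof.
(* [lfunE] speaks of linear functions, so the bare function in the definition of [refl] is first
   given its linear structure. *)
have L : linear (fun H : t => H - dot r H *: coroot r).
  move=> a x y; rewrite dotDr dotZr scalerDl scalerBr !scalerA opprD.
  by rewrite addrACA.
pose f := GRing.isLinear.Build R t t *:%R _ L.
pose f' : {linear t -> t} := HB.pack (fun H : t => H - dot r H *: coroot r) f.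
by rewrite /refl (lfunE f').
Qed.

Lemma dot_coroot_refl r s : s - dot s (coroot r) *: r = refl r s.
Proof. by rewrite reflE /coroot dotZr scalerA (dotC r s) [_ * dot s r]mulrC. Qed.

Lemma dot_coroot r : r != 0 -> dot r (coroot r) = 2.
Proof. by move=> /dot_gt0 r0; rewrite /coroot dotZr mulfVK // gt_eqF. Qed.

Lemma coroot_neq0 r : r != 0 -> coroot r != 0.
Proof.
move=> r0; apply/eqP => h; have := dot_coroot r0; rewrite h dot0r.
by move/eqP; rewrite eq_sym pnatr_eq0.
Qed.

Lemma corootN r : coroot (- r) = - coroot r.
Proof. by rewrite /coroot dotNl dotNr opprK scalerN. Qed.

Lemma reflN r : refl (- r) = refl r.
Proof.
by apply/lfunP => H; rewrite !reflE corootN dotNl scaleNr scalerN opprK.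
Qed.

Lemma refl_dot r x y : dot (refl r x) y = dot x (refl r y).
Proof.
rewrite !reflE /coroot !scalerA dotBl dotBr dotZl dotZr (dotC x r).
by congr (_ - _); ring.
Qed.

Lemma reflK r : r != 0 -> involutive (refl r).
Proof.
move=> r0 H; rewrite -dot_coroot_refl -(dot_coroot_refl r H) dotBl dotZl dot_coroot //.
set a := dot H _.
rewrite -!(scaleNr _ r) -addrA -scalerDl (_ : - a + - (a - a * 2) = 0); last by ring.
by rewrite scale0r addr0.
Qed.

Lemma inclD (x y : cpt K) : incl (x + y) = incl x + incl y.
Proof. by have := @incl_linear R K 1 x y; rewrite !scale1r. Qed.

Lemma incl0 : incl (0 : cpt K) = 0.
Proof. by apply: (addrI (incl (0 : cpt K))); rewrite -inclD !addr0. Qed.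

Lemma inclZ a (x : cpt K) : incl (a *: x) = (a%:C)%C *: incl x.
Proof. by have := @incl_linear R K a x 0; rewrite incl0 !addr0. Qed.

Lemma inclN (x : cpt K) : incl (- x) = - incl x.
Proof. by apply: (addrI (incl x)); rewrite -inclD !subrr incl0. Qed.

Lemma inclB (x y : cpt K) : incl (x - y) = incl x - incl y.
Proof. by rewrite inclD inclN. Qed.

Lemma incl_inj2 (x y x' y' : cpt K) :
  incl x + I *: incl y = incl x' + I *: incl y' -> x = x' /\ y = y'.
Proof.
move=> e; have [p [_ hp]] := incl_cplx (incl x + I *: incl y).
by have := hp (x, y) erefl; have := hp (x', y') e; move=> -> [-> ->].
Qed.

Lemma incl_eq0 (x : cpt K) : incl x = 0 -> x = 0.
Proof.
move=> x0; apply: (proj1 (@incl_inj2 x 0 0 0 _)).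
by rewrite x0 incl0.
Qed.

Lemma cplx_decomp (z : cplx K) : exists x y : cpt K, z = incl x + I *: incl y.
Proof. by have [[x y] [h _]] := incl_cplx z; exists x, y. Qed.

Lemma sqrI : I * I = -1.
Proof. by simpc. Qed.

Lemma imI (a : R) : (0 +i* a)%C = I * (a%:C)%C.
Proof. by simpc. Qed.

Lemma realCN (a : R) : (- a)%:C%C = - a%:C%C.
Proof. by simpc. Qed.

Lemma realCD (a b : R) : (a + b)%:C%C = a%:C%C + b%:C%C.
Proof. by simpc. Qed.

Lemma realCM (a b : R) : (a * b)%:C%C = a%:C%C * b%:C%C.
Proof. by simpc. Qed.

Lemma torus_br H H' : lie_br (vsval H) (vsval H') = 0.
Proof. by have /torus_max_abelian := subvsP H; apply; exact: subvsP. Qed.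

End Torus.

(** * Roots, sl2-triples and weights *)

Section SL2.
Variables (R : realType) (K : compactDatum R).
Implicit Types (r s H : tor K).
Local Notation t := (tor K).
Local Notation I := (0 +i* 1 : R[i])%C.

Lemma vsvalP_ex (z : cpt K) : z \in torus K -> exists H : t, z = vsval H.
Proof. by move=> zt; exists (Subvs zt). Qed.

(* For a root vector e = x + iy one has [H, x] = - <r, H> y and
   [H, y] = <r, H> x, so that [x, y] centralises the torus and hence lies in
   it; invariance of the inner product gives [x, y] = - |x|^2 r. *)
Lemma sl2_triple r : is_root r -> exists e f : cplx K,
  [/\ forall H, lie_br (incl (vsval H)) e = (0 +i* dot r H)%C *: e,
      forall H, lie_br (incl (vsval H)) f = (0 +i* dot (- r) H)%C *: f
    & lie_br e f = - I *: incl (vsval (coroot r))].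
Proof.
move=> [r0 [e e0 He]]; have [x [y eE]] := cplx_decomp e.
have Hxy H : lie_br (vsval H) x = - (dot r H) *: y /\ lie_br (vsval H) y = dot r H *: x.
  apply: incl_inj2; rewrite !incl_br; move: (He H); rewrite eE.
  rewrite lie_brDr lie_brZr => ->.
  rewrite imI !inclZ scalerDr !scalerA addrC; congr (_ + _).
    by rewrite mulrAC sqrI mulN1r rmorphN.
have x0 : x != 0.
  apply/eqP => x0; move: (Hxy r) => [_]; rewrite x0 scaler0 => yr.
  have [h _] := Hxy r; move: h; rewrite x0 lie_br0r => /esym/eqP.
  rewrite scaler_eq0 oppr_eq0 gt_eqF ?dot_gt0 //= => /eqP y0.
  by move: e0; rewrite eE x0 y0 incl0 scaler0 addr0 eqxx.
have tz : lie_br x y \in torus K.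
  apply/torus_max_abelian => _ /(vsvalP_ex)[H ->]; rewrite lie_brN.
  have := lie_jacobi (vsval H) x y.
  rewrite (lie_brN (vsval H) y) (Hxy H).1 (Hxy H).2 lie_brNr !lie_brZr.
  rewrite !lie_br_alt !scaler0 oppr0 !addr0; by move=> ->; rewrite oppr0.
pose n := inner K x x; have n0 : 0 < n by exact: neq0_dnorm_gt0.
have zE : lie_br x y = - n *: vsval r.
  have [z zE] := vsvalP_ex tz; rewrite zE; suff -> : z = - n *: r by rewrite linearZ.
  apply: dot_ext => H; rewrite dotZl {1}/dot -zE inner_invariant lie_brN.
  by rewrite (Hxy H).2 -scaleNr linearZr_LR /= mulNr mulrC -mulNr mulrC.
have r2 : 0 < dot r r by exact: dot_gt0.
(* For e = x + iy one has [e, x - iy] = -2i [x, y] = 2i n r, and this factor turns it into -i times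
   the coroot 2r / <r, r>. *)
exists e, ((- (n * dot r r)^-1)%:C%C *: (incl x - I *: incl y)); split=> //.
  move=> H; rewrite lie_brZr lie_brDr lie_brNr lie_brZr -!incl_br.
  rewrite (Hxy H).1 (Hxy H).2 !inclZ.
  set c := (- _)%:C%C; rewrite [RHS]scalerA [in RHS](mulrC _ c) -[RHS]scalerA.
  congr (_ *: _); rewrite imI dotNl scalerBr !scalerA mulrAC sqrI mulN1r.
  by rewrite !realCN mulrN !scaleNr opprK addrC.
rewrite lie_brZr eE lie_brDr lie_brNr lie_brZr !lie_brDl !lie_brZl.
rewrite -!incl_br !lie_br_alt incl0 scaler0 add0r addr0 (lie_brN x y) inclN zE.
rewrite inclZ (realCN n) scaleNr opprK scalerN opprK -mulr2n -scaler_nat.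
have -> : vsval (coroot r) = (2 / dot r r) *: vsval r by rewrite linearZ.
rewrite inclZ !scalerA; congr (_ *: _).
rewrite realCN.
have -> : 2 / dot r r = (n * dot r r)^-1 * 2 * n.
  by rewrite invfM mulrAC [n^-1 * _ * n]mulrAC mulVf ?gt_eqF // mul1r mulrC.
rewrite !realCM.
have -> : (2 : R)%:C%C = 2 by rewrite rmorph_nat.
by ring.
Qed.

End SL2.

Section Weights.
Variables (R : realType) (K : compactDatum R).
Implicit Types (r s H : tor K).
Local Notation t := (tor K).
Local Notation I := (0 +i* 1 : R[i])%C.

(** The [f] of the sl2-triple is a root vector for - r, nonzero because [e, f] is a nonzero multiple
    of the coroot. *)
Lemma is_rootN r : is_root r -> is_root (- r).
Proof.
move=> rr; have [e [f [_ Hf ef]]] := sl2_triple rr; have [r0 _] := rr.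
split; first by rewrite oppr_eq0.
exists f => //; apply/eqP => f0; move: ef; rewrite f0 lie_br0r => /esym/eqP.
rewrite scaler_eq0 oppr_eq0 eq_complex /= oner_eq0 andbF /= => /eqP/incl_eq0 h.
have /eqP : coroot r = 0 by apply: val_inj; rewrite linear0.
by rewrite (negbTE (coroot_neq0 r0)).
Qed.

Section Rep.
Variable V : lieRep (cplx K).
Local Notation rho := (rep_map V).
Local Notation wv := (@weight_vector R K V).

Lemma imB_neq s s' H : dot s H <> dot s' H ->
  (0 +i* dot s H)%C <> (0 +i* dot s' H)%C.
Proof. by move=> h [/h]. Qed.

Lemma has_weight_finite : finite_set (has_weight V).
Proof.
rewrite (_ : has_weight V = [set s | exists2 v : V,
    (forall H, rho (incl (vsval H)) v = (0 +i* dot s H)%C *: v) & v != 0]) //.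
apply: (@eigen_labels_finite R[i] V t t (fun H => rho (incl (vsval H)))
  (fun s H => (0 +i* dot s H)%C)).
  by move=> H a x y; rewrite linearP.
(* Two weights are told apart on H = s - s', where their values differ by |s - s'|^2. *)
move=> s s' ss'; exists (s - s'); apply: imB_neq => /eqP.
by rewrite -subr_eq0 -dotBl => /eqP/dot_eq0/eqP; rewrite subr_eq0 => /eqP.
Qed.

Lemma lin_closed_wv s : lin_closed (wv s).
Proof.
split=> [H|a x y hx hy H]; first by rewrite linear0 scaler0.
by rewrite linearD linearZ /= (hx H) (hy H) scalerDr !scalerA mulrC.
Qed.

Lemma rep_brE x y v : rho (lie_br x y) v = rho x (rho y v) - rho y (rho x v).
Proof. by rewrite rep_map_br add_lfunE opp_lfunE !comp_lfunE. Qed.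

Lemma rep_scale a x v : rho (a *: x) v = a *: rho x v.
Proof. by rewrite linearZ /= scale_lfunE. Qed.

Lemma wv_shift s r e v : (forall H, lie_br (incl (vsval H)) e = (0 +i* dot r H)%C *: e) ->
  wv s v -> wv (s + r) (rho e v).
Proof.
move=> He hv H; have := rep_brE (incl (vsval H)) e v.
rewrite He rep_scale hv linearZ /= => /eqP.
rewrite eq_sym subr_eq => /eqP ->; rewrite -scalerDl; congr (_ *: _).
by rewrite dotDl; simpc; rewrite addrC.
Qed.

(** * The sl2-ladder of a root in a representation *)

Section Ladder.
Variables (r : t) (e f : cplx K).
Hypothesis rr : is_root r.
Hypothesis He : forall H, lie_br (incl (vsval H)) e = (0 +i* dot r H)%C *: e.
Hypothesis Hf : forall H, lie_br (incl (vsval H)) f = (0 +i* dot (- r) H)%C *: f.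
Hypothesis ef : lie_br e f = - I *: incl (vsval (coroot r)).

Local Notation E := (rho e).
Local Notation G := (rho f).
Local Notation hgt s := (dot s (coroot r)).

Lemma wv_E n s v : wv s v -> wv (s + r *+ n) (iter n E v).
Proof.
move=> hv; elim: n => [|n IHn] /=; first by rewrite addr0.
by rewrite mulrSr addrA; apply: wv_shift.
Qed.

Lemma wv_G n s v : wv s v -> wv (s - r *+ n) (iter n G v).
Proof.
move=> hv; elim: n => [|n IHn] /=; first by rewrite subr0.
by rewrite mulrSr opprD addrA; apply: wv_shift.
Qed.

Lemma commEG s v : wv s v -> E (G v) = G (E v) + (hgt s)%:C%C *: v.
Proof.
move=> hv; have := rep_brE e f v; rewrite ef rep_scale (hv (coroot r)) scalerA.
move=> /eqP; rewrite eq_sym subr_eq => /eqP ->; rewrite addrC; congr (_ + _ *: _).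
by simpc.
Qed.

Lemma hgt_shift s n : hgt (s + r *+ n) = hgt s + n%:R * 2.
Proof.
have [r0 _] := rr.
by rewrite dotDl -scaler_nat dotZl dot_coroot.
Qed.

Lemma hgt_shiftN s n : hgt (s - r *+ n) = hgt s - n%:R * 2.
Proof.
have [r0 _] := rr.
by rewrite dotBl -scaler_nat dotZl dot_coroot.
Qed.

Lemma shift_injective (r' : t) s : r' != 0 -> injective (fun n : nat => s + r' *+ n).
Proof.
move=> r0 m n /addrI /eqP; rewrite -subr_eq0 -!(scaler_nat _ r') -scalerBl scaler_eq0.
by rewrite (negbTE r0) orbF subr_eq0 eqr_nat => /eqP.
Qed.

(** Otherwise all the s + n r', distinct since r' is nonzero, would be weights of V. *)
Lemma iter_eq0 (r' : t) (X : 'End(V)) s v : r' != 0 ->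
  (forall n, wv (s + r' *+ n) (iter n X v)) -> exists n, iter n X v = 0.
Proof.
move=> r0 hX; apply: contrapT => no.
have := finite_preimage (f := fun n : nat => s + r' *+ n) _ has_weight_finite.
move=> fin; apply: infinite_nat; apply: (sub_finite_set _ (fin _)).
  move=> n _ /=; exists (iter n X v); first exact: hX.
  by apply/eqP => h; apply: no; exists n.
by move=> m n _ _; exact: (@shift_injective r').
Qed.

Lemma last_nonzero (X : 'End(V)) v : v != 0 -> (exists n, iter n X v = 0) ->
  exists n, iter n X v != 0 /\ iter n.+1 X v = 0.
Proof.
move=> v0 [n]; elim: n => [|n IHn] hn; first by rewrite /= in hn; rewrite hn eqxx in v0.
have [/eqP/IHn//|h] := boolP (iter n X v == 0).
by exists n.
Qed.

Lemma E_nilpotent s v : wv s v -> exists n, iter n E v = 0.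
Proof. by have [r0 _] := rr; move=> hv; apply: (@iter_eq0 r _ s) => // n; exact: wv_E. Qed.

Lemma G_nilpotent s v : wv s v -> exists n, iter n G v = 0.
Proof.
have [r0 _] := rr; move=> hv; apply: (@iter_eq0 (- r) _ s); first by rewrite oppr_eq0.
by move=> n; rewrite mulNrn; exact: wv_G.
Qed.

(** The usual sl2 commutation, with the term [G (E v)] kept because v need not be a highest weight
    vector. The common outer [iter j G] is what makes the induction of [iterG_inj] possible. *)
Lemma E_iterG s v j : wv s v ->
  E (iter j.+1 G v) = iter j G (G (E v) + (j.+1%:R * (hgt s - j%:R))%:C%C *: v).
Proof.
move=> hv; elim: j => [|j IHj]; first by rewrite /= (commEG hv) mul1r subr0.
have hw := wv_G j.+1 hv.
rewrite iterS (commEG hw) IHj hgt_shiftN -iterS !iterSr -!iterSr.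
have iterD (n : nat) x y : iter n G (x + y) = iter n G x + iter n G y.
  by elim: n => //= n ->; rewrite linearD.
have iterZ (n : nat) a x : iter n G (a *: x) = a *: iter n G x.
  by elim: n => //= n ->; rewrite linearZ.
(* With h the height of s, the coefficients add up as (j+1)(h - j) + h - 2(j+1) = (j+2)(h -
   (j+1)). *)
rewrite !iterD !iterZ -addrA -scalerDl; congr (_ + _ *: _).
rewrite -realCD; congr (_%:C%C); rewrite -!natr1; ring.
Qed.

(** Climb n times with E to a last nonzero u, then descend to a last nonzero G^m u. The ladder
    identity becomes 0 = (m+1)(hgt u - m) G^m u, so hgt s + 2n = hgt u = m. *)
Lemma weight_integral s v : wv s v -> v != 0 -> hgt s \is a Num.int.
Proof.
move=> hv v0; have [n [un0 uE]] := last_nonzero v0 (E_nilpotent hv).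
set u := iter n E v in un0 uE; have hu : wv (s + r *+ n) u by exact: wv_E.
have [m [um0 uG]] := last_nonzero un0 (G_nilpotent hu).
have := E_iterG m hu; rewrite uG linear0 [E u]uE linear0 add0r.
have iterZ (k : nat) a x : iter k G (a *: x) = a *: iter k G x.
  by elim: k => //= k ->; rewrite linearZ.
rewrite iterZ => /esym/eqP; rewrite scaler_eq0 (negbTE um0) orbF eq_complex /= eqxx andbT.
rewrite mulf_eq0 pnatr_eq0 /= hgt_shift subr_eq0 => /eqP h.
have -> : hgt s = m%:R - n%:R * 2 by rewrite -h addrK.
by apply: rpredB; [exact: rpred_nat | apply: rpredM; exact: rpred_nat].
Qed.

(* A negative eigenvalue of [G E] would make every [E ^ k v] nonzero. *)
Lemma GE_no_neg_eigenvalue s v (c : R) : wv s v -> 0 <= hgt s -> 0 < c ->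
  G (E v) = - c%:C%C *: v -> v = 0.
Proof.
move=> hv s0 c0 hc.
have step k : exists2 d : R, 0 < d & G (iter k.+1 E v) = - d%:C%C *: iter k E v.
  elim: k => [|k [d d0 IHk]]; first by exists c.
  exists (d + hgt (s + r *+ k.+1)).
    by rewrite hgt_shift ltr_wpDr // addr_ge0.
  have := commEG (wv_E k.+1 hv); rewrite IHk linearZ /= => /eqP.
  rewrite -subr_eq => /eqP <-.
  by rewrite realCD opprD scalerDl !scaleNr.
have [n] := E_nilpotent hv; elim: n => // n IHn hn; apply: IHn.
have [d d0] := step n; rewrite hn linear0 => /esym/eqP.
by rewrite scaler_eq0 oppr_eq0 eq_complex /= eqxx andbT gt_eqF // => /eqP.
Qed.

(** If G^(j+1) v = 0, then G^j kills w = G (E v) + (j+1)(m - j) v, again of weight s, so w = 0 by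
    induction. Then v has eigenvalue -(j+1)(m - j) under [G E], negative as j < m, and such a v
    vanishes. *)
Lemma iterG_inj s v m j : hgt s = m%:R -> (j <= m)%N -> wv s v ->
  iter j G v = 0 -> v = 0.
Proof.
move=> sm; elim: j v => [//|j IHj] v jm hv h.
have := E_iterG j hv; rewrite h linear0 => /esym.
set w := _ + _ => hw; have w0 : w = 0.
  apply: IHj => //; first exact: ltnW.
  apply: (lin_closedD (lin_closed_wv s)); last exact: (lin_closedZ _ (lin_closed_wv s)).
  have := wv_shift Hf (wv_shift He hv).
  by rewrite addrK.
apply: (@GE_no_neg_eigenvalue s v (j.+1%:R * (hgt s - j%:R))) => //.
- by rewrite sm.
- by rewrite mulr_gt0 // sm subr_gt0 ltr_nat.
- by apply/eqP; rewrite scaleNr -addr_eq0; apply/eqP.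
Qed.

Lemma fdim_wv_le s : 0 <= hgt s -> (fdim (wv s) <= fdim (wv (refl r s)))%N.
Proof.
move=> s0; have [U hU] := lin_closed_vspace (lin_closed_wv s).
have [U' hU'] := lin_closed_vspace (lin_closed_wv (refl r s)).
rewrite (fdim_vspace hU) (fdim_vspace hU').
(* Integrality of the height rests on a nonzero weight vector, hence the separate case. Afterwards
   the height is a natural number m and G^m maps into the reflected weight space. *)
have [->|U0] := eqVneq U 0%VS; first by rewrite dimv0.
have uU := memv_pick U; have u0 : vpick U != 0 by rewrite vpick0.
have /intrP[z sz] := weight_integral ((hU _).2 uU) u0.
case: z sz => [m|m] sz; last by move: s0; rewrite sz NegzE mulrNz oppr_ge0 -pmulrn lern0.
pose X := iter m (fun X => G \o X)%VF \1%VF.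
have XE v : X v = iter m G v.
  rewrite /X; elim: (m) => [|n IHn] /=; first by rewrite id_lfunE.
  by rewrite comp_lfunE IHn.
have kerX : (U :&: lker X)%VS = 0%VS.
  apply/eqP; rewrite -subv0; apply/subvP => v /memv_capP[/hU vU].
  rewrite memv_ker XE => /eqP /(iterG_inj sz (leqnn m) vU) ->.
  by rewrite memv0.
rewrite -(limg_dim_eq kerX); apply: dimvS; apply/subvP => _ /memv_imgP[v /hU vU ->].
apply/hU'; rewrite XE -dot_coroot_refl sz -pmulrn scaler_nat; exact: wv_G.
Qed.

End Ladder.

Lemma weight_dot_int s r : has_weight V s -> is_root r -> dot s (coroot r) \is a Num.int.
Proof.
move=> [v hv v0] rr; have [e [f [He Hf ef]]] := sl2_triple rr.
exact: (weight_integral rr He Hf ef hv v0).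
Qed.

(** The roots r and - r have the same reflection and opposite heights, so one of them gives the
    inequality for any s; applied to the reflected weight it gives the converse. *)
Lemma fdim_wv_refl s r : is_root r -> fdim (wv (refl r s)) = fdim (wv s).
Proof.
move=> rr.
have le s' : (fdim (wv s') <= fdim (wv (refl r s')))%N.
  have [s0|s0] := leP 0 (dot s' (coroot r)).
    have [e [f [He Hf ef]]] := sl2_triple rr.
    exact: (fdim_wv_le rr He Hf ef s0).
  have [e [f [He Hf ef]]] := sl2_triple (is_rootN rr).
  rewrite -reflN; apply: (fdim_wv_le (is_rootN rr) He Hf ef).
  by rewrite corootN dotNr oppr_ge0 ltW.
apply/eqP; rewrite eqn_leq le andbT.
by rewrite -[X in (_ <= fdim (wv X))%N](reflK rr.1 s).
Qed.

End Rep.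

Lemma is_rootP r : is_root r <-> r != 0 /\ has_weight (adjoint (cplx K)) r.
Proof.
split=> -[r0 [x h1 h2]]; split=> //; exists x => // H; first by rewrite adE.
by have := h1 H; rewrite adE.
Qed.

Lemma root_dot_int r r2 : is_root r -> is_root r2 -> dot r (coroot r2) \is a Num.int.
Proof. by move=> /is_rootP[_ hr]; exact: (@weight_dot_int (adjoint (cplx K)) r r2 hr). Qed.

Lemma root_finite : finite_set (@is_root R K).
Proof.
apply: (sub_finite_set _ (has_weight_finite (adjoint (cplx K)))).
by move=> r /is_rootP[].
Qed.

End Weights.

(** * Roots span the torus algebra *)

Section CommonEigenvector.
Variables (C : numClosedFieldType) (V : vectType C).

Lemma eigenvector_in (X : 'End(V)) (U : {vspace V}) :
  U != 0%VS -> (forall v, v \in U -> X v \in U) ->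
  exists a, exists2 v, v \in U & v != 0 /\ X v = a *: v.
Proof.
move=> U0 XU; have n0 : (0 < \dim U)%N by rewrite lt0n dimv_eq0.
pose M : 'M[C]_(\dim U) :=
  \matrix_(i, j) coord (vbasis U) j (X (vbasis U)`_i).
have [a /eigenvalueP[w wM w0]] := eigenvalue_closed M n0.
have bU (i : 'I_(\dim U)) : (vbasis U)`_i \in U.
  by apply: vbasis_mem; rewrite mem_nth // size_tuple.
exists a, (\sum_i w 0 i *: (vbasis U)`_i).
  by apply: memv_suml => i _; apply: memvZ.
split.
  apply/eqP => h; move/eqP: w0; apply; apply/rowP => i; rewrite mxE.
  by have /freeP := basis_free (vbasisP U); apply.
rewrite linear_sum scaler_sumr.
under eq_bigr => i _.
  rewrite linearZ /= {1}(coord_vbasis (XU _ (bU i))) scaler_sumr.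
  under eq_bigr do rewrite scalerA.
  over.
rewrite exchange_big /=; apply: eq_bigr => j _; rewrite -scaler_suml scalerA.
congr (_ *: _); move/rowP/(_ j): wM; rewrite !mxE => <-.
by apply: eq_bigr => i _; rewrite mxE.
Qed.

(** On a nonzero stable subspace of least dimension each operator is scalar, because its eigenspace
    there is nonzero and stable under the commuting family. The family may be infinite, as it is for
    the whole torus. *)
Lemma common_eigenvector_in (J : Type) (X : J -> 'End(V)) (U : {vspace V}) :
  (forall i j v, X i (X j v) = X j (X i v)) ->
  U != 0%VS -> (forall j v, v \in U -> X j v \in U) ->
  exists2 v, v \in U & v != 0 /\ forall j, exists a, X j v = a *: v.
Proof.
move=> comm U0 XU.
pose P n := `[< exists W : {vspace V}, [/\ (W <= U)%VS, W != 0%VS,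
  forall j v, v \in W -> X j v \in W & \dim W = n] >].
have exP : exists n, P n by exists (\dim U); apply/asboolP; exists U.
case: (ex_minnP exP) => n /asboolP[W [WU W0 XW dW]] nmin.
exists (vpick W); first by apply: (subvP WU); exact: memv_pick.
split=> [|j]; first by rewrite vpick0.
have [a [v vW [v0 Xv]]] := eigenvector_in W0 (XW j).
exists a; pose W' := (W :&: lker (X j - a *: \1%VF))%VS.
have W'P u : (u \in W') = (u \in W) && (X j u == a *: u).
  by rewrite memv_cap memv_ker add_lfunE opp_lfunE scale_lfunE id_lfunE subr_eq0.
have : P (\dim W').
  apply/asboolP; exists W'; split=> //.
  - by apply: subv_trans (capvSl _ _) WU.
  - by apply: contraNneq v0 => W'0; rewrite -memv0 -W'0 W'P vW Xv eqxx.
  - move=> i u; rewrite !W'P => /andP[uW /eqP Xu].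
    by rewrite XW //= comm Xu linearZ.
move=> /nmin; rewrite -dW => le.
have /eqP W'W : W' == W by rewrite eqEdim capvSl.
by have : vpick W \in W' by [rewrite W'W memv_pick]; rewrite W'P => /andP[_ /eqP].
Qed.

End CommonEigenvector.

Section TorusDual.
Variables (R : realType) (K : compactDatum R).
Local Notation t := (tor K).

Definition dot_map (m : nat) (e : 'I_m -> t) (H : t) : 'rV[R]_m :=
  \row_i dot H (e i).

Fact dot_map_linear m (e : 'I_m -> t) : linear (dot_map e).
Proof. by move=> a x y; apply/rowP => i; rewrite !mxE dotDl dotZl. Qed.

HB.instance Definition _ m (e : 'I_m -> t) :=
  GRing.isLinear.Build R t 'rV[R]_m *:%R (dot_map e) (dot_map_linear e).

(** Spanning, expressed by a trivial orthogonal complement: this is the form in which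
    [roots_separate] supplies it. *)
Definition complete (m : nat) (e : 'I_m -> t) : Prop :=
  forall H, (forall i, dot H (e i) = 0) -> H = 0.

Lemma ker_dot_map m (e : 'I_m -> t) : complete e ->
  ({:t} :&: lker (linfun (dot_map e)))%VS = 0%VS.
Proof.
move=> ce; apply/eqP; rewrite -subv0; apply/subvP => H.
rewrite memv_cap memv_ker lfunE /= => /andP[_ /eqP h]; rewrite memv0.
by apply/eqP/ce => i; move/rowP/(_ i): h; rewrite !mxE.
Qed.

Lemma dim_le_complete m (e : 'I_m -> t) : complete e -> (\dim {:t} <= m)%N.
Proof.
move=> /ker_dot_map k0; rewrite -(limg_dim_eq k0) (leq_trans (dimvS (subvf _))) //.
by rewrite dimvf dim_matrix mul1r.
Qed.

(** The pairing map is injective by completeness, hence onto when the dimensions agree. *)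
Lemma dot_solve m (e : 'I_m -> t) (c : 'I_m -> R) : complete e -> \dim {:t} = m ->
  exists r, forall i, dot r (e i) = c i.
Proof.
move=> ce dt; have : limg (linfun (dot_map e)) == fullv.
  rewrite eqEdim subvf (limg_dim_eq (ker_dot_map ce)) dt.
  by rewrite dimvf dim_matrix mul1r leqnn.
move=> /eqP full; have : \row_i c i \in limg (linfun (dot_map e)).
  by rewrite full memvf.
move=> /memv_imgP[r _ rE]; exists r => i.
by move/rowP/(_ i): rE; rewrite lfunE !mxE.
Qed.

Lemma basis_complete (e : seq t) : basis_of {:t} e ->
  complete (fun i : 'I_(size e) => e`_i).
Proof.
move=> be H h; apply/dot_eq0.
have /coord_span {2}-> : H \in <<in_tuple e>>%VS by rewrite (span_basis be) memvf.
by rewrite dot_sumr big1 // => i _; rewrite dotZr h mulr0.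
Qed.

Section DualFamilies.
Variables (m : nat) (e d : 'I_m -> t).
Hypothesis ce : complete e.
Hypothesis ed : forall i j, dot (d i) (e j) = (i == j)%:R.

Lemma dual_expansion H : H = \sum_i dot H (e i) *: d i.
Proof.
apply/eqP; rewrite -subr_eq0; apply/eqP/ce => j; rewrite dotBl dot_suml.
rewrite (bigD1 j) //= big1 => [|i ij].
  by rewrite addr0 dotZl ed eqxx mulr1 subrr.
by rewrite dotZl ed (negbTE ij) mulr0.
Qed.

Lemma dual_complete : complete d.
Proof.
move=> H h; apply: dot_eq0; rewrite {2}(dual_expansion H) dot_sumr.
by rewrite big1 // => i _; rewrite dotZr h mulr0.
Qed.

End DualFamilies.

End TorusDual.

Section RootsSpan.
Variables (R : realType) (K : compactDatum R).
Local Notation t := (tor K).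
Local Notation I := (0 +i* 1 : R[i])%C.
Implicit Types H : t.

Lemma innerC (x y : cpt K) : inner K x y = inner K y x.
Proof. by rewrite hermC expr0 mul1r. Qed.

Lemma innerDl (x y z : cpt K) : inner K (x + y) z = inner K x z + inner K y z.
Proof. by rewrite linearDl. Qed.

Lemma innerZl a (x z : cpt K) : inner K (a *: x) z = a * inner K x z.
Proof. by rewrite linearZl_LR. Qed.

Lemma innerNl (x z : cpt K) : inner K (- x) z = - inner K x z.
Proof. by rewrite -scaleN1r innerZl mulN1r. Qed.

Lemma inner0l (x : cpt K) : inner K 0 x = 0.
Proof. by rewrite -(scale0r 0) innerZl mul0r. Qed.

Lemma inner_gt0 (x : cpt K) : x != 0 -> 0 < inner K x x.
Proof. exact: neq0_dnorm_gt0. Qed.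

Lemma inner_eq0 (x : cpt K) : inner K x x = 0 -> x = 0.
Proof. by move=> hx; apply/eqP; apply: contraT => /inner_gt0; rewrite hx ltxx. Qed.

Lemma inner_ge0 (x : cpt K) : 0 <= inner K x x.
Proof. by have [->|/inner_gt0/ltW//] := eqVneq x 0; rewrite inner0l. Qed.

Lemma inner_ad (x u : cpt K) : inner K (lie_br x u) (lie_br x u) =
  - inner K u (lie_br x (lie_br x u)).
Proof. by rewrite {1}lie_brN innerNl inner_invariant. Qed.

Lemma cplx_br_eq0 (x : cpt K) (u v : cpt K) :
  lie_br (incl x) (incl u + I *: incl v) = 0 -> lie_br x u = 0 /\ lie_br x v = 0.
Proof.
rewrite lie_brDr lie_brZr -!incl_br => h; apply: incl_inj2.
by rewrite h incl0 scaler0 addr0.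
Qed.

(* [ad (incl x)] is skew for the inner product, hence its kernel meets its
   image trivially. *)
Lemma ad_sq_eq0 (x : cpt K) (z : cplx K) :
  lie_br (incl x) (lie_br (incl x) z) = 0 -> lie_br (incl x) z = 0.
Proof.
have [u [v ->]] := cplx_decomp z.
rewrite [X in lie_br _ X]lie_brDr [X in lie_br _ (_ + X)]lie_brZr -!incl_br.
move=> /cplx_br_eq0[hu hv].
have ker_im w : lie_br x (lie_br x w) = 0 -> lie_br x w = 0.
  by move=> hw; apply: inner_eq0; rewrite inner_ad hw innerC inner0l oppr0.
by rewrite lie_brDr lie_brZr -!incl_br (ker_im _ hu) (ker_im _ hv) incl0 scaler0 addr0.
Qed.

(** Since [ad x] is skew, pairing its values on the real and imaginary parts u, v of e with u and v
    gives a (|u|^2 + |v|^2) = 0 for the real part a of c. *)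
Lemma ad_eigenvalue_imaginary (x : cpt K) (e : cplx K) (c : R[i]) :
  e != 0 -> lie_br (incl x) e = c *: e -> exists b : R, c = (0 +i* b)%C.
Proof.
have [u [v eE]] := cplx_decomp e; case: c => a b e0 hc; exists b.
have [hu hv] : lie_br x u = a *: u - b *: v /\ lie_br x v = a *: v + b *: u.
  apply: incl_inj2; rewrite !incl_br -lie_brZr -lie_brDr -eE hc eE.
  have -> : (a +i* b)%C = a%:C%C + I * b%:C%C by simpc.
  rewrite inclB inclD !inclZ !scalerDl !scalerDr !scalerA.
  rewrite (_ : I * b%:C%C * I = - b%:C%C) ?scaleNr; last first.
    by rewrite mulrAC sqrI mulN1r.
  by rewrite [_ * I]mulrC -!addrA; congr (_ + _); rewrite addrA addrC.
have skew w : inner K (lie_br x w) w = 0 by rewrite inner_invariant lie_br_alt innerC inner0l.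
have := skew u; have := skew v.
rewrite hu hv !innerDl innerNl !innerZl (innerC u v) => h1 h2.
have h : a * (inner K u u + inner K v v) = 0.
  by rewrite mulrDr -[RHS]addr0 -{1}h1 -h2; ring.
congr (_ +i* _)%C; move/eqP: h; rewrite mulf_eq0 => /orP[/eqP//|/eqP h].
have u0 : u = 0.
  by apply: inner_eq0; have := inner_ge0 u; have := inner_ge0 v; lra.
have v0 : v = 0.
  by apply: inner_eq0; have := inner_ge0 u; have := inner_ge0 v; lra.
by move: e0; rewrite eE u0 v0 incl0 scaler0 addr0 eqxx.
Qed.

Lemma ad_torus_comm H H' (z : cplx K) :
  lie_br (incl (vsval H)) (lie_br (incl (vsval H')) z) =
  lie_br (incl (vsval H')) (lie_br (incl (vsval H)) z).
Proof.
apply/eqP; rewrite -subr_eq0; apply/eqP.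
have := congr1 (fun f : 'End(cplx K) => f z) (ad_br (incl (vsval H)) (incl (vsval H'))).
rewrite -incl_br torus_br incl0 add_lfunE opp_lfunE !comp_lfunE !adE lie_br0l.
by move=> <-.
Qed.

(** The joint eigenvector e is sought inside the image of ad H. Its weight is zero or a root, so ad
    H kills e, whereas ad H is injective on its own image. *)
Lemma roots_separate H : (forall r, is_root r -> dot r H = 0) -> H = 0.
Proof.
move=> rH; pose T := ad (incl (vsval H)).
have [/eqP T0|T0] := boolP (limg T == 0%VS).
  (* Here H is central, so its line is an ideal: either zero, or the whole algebra, which would then
     be abelian. *)
  have brH z : lie_br (incl (vsval H)) z = 0.
    by rewrite -adE; apply/eqP; rewrite -memv0 -T0 memv_img // memvf.
  have [[x [y xy0]] simple] := cplx_simple K.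
  have [|L0|Lf] := simple <[incl (vsval H)]>%VS.
  - by move=> a _ /vlineP[c ->]; rewrite lie_brZr lie_brN brH oppr0 scaler0 mem0v.
  - have : incl (vsval H) \in <[incl (vsval H)]>%VS by exact: memv_line.
    by rewrite L0 memv0 => /eqP/incl_eq0 h; apply: val_inj; rewrite linear0.
  - have /vlineP[c xE] : x \in <[incl (vsval H)]>%VS by rewrite Lf memvf.
    by move: xy0; rewrite xE lie_brZl brH scaler0 eqxx.
have [||e eT [e0 he]] := @common_eigenvector_in R[i] (cplx K) t
    (fun H' => ad (incl (vsval H'))) (limg T) _ T0.
- by move=> H1 H2 z; rewrite !adE ad_torus_comm.
- move=> H1 _ /memv_imgP[z _ ->]; rewrite !adE ad_torus_comm -adE.
  by rewrite memv_img // memvf.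
have /choice[c hc] H' : exists b : R, lie_br (incl (vsval H')) e = (0 +i* b)%C *: e.
  have [a] := he H'; rewrite adE => ha.
  by have [b bE] := ad_eigenvalue_imaginary e0 ha; exists b; rewrite ha bE.
(* The eigenvalues on e depend linearly on H', so matching them on a basis of the torus determines
   the weight r of e. *)
have [r hr] := dot_solve (fun i => c (vbasis {:t})`_i)
  (basis_complete (vbasisP {:t})) (esym (size_tuple _)).
have rE H' : lie_br (incl (vsval H')) e = (0 +i* dot r H')%C *: e.
  have -> : H' = \sum_i coord (vbasis {:t}) i H' *: (vbasis {:t})`_i.
    by apply: coord_vbasis; rewrite memvf.
  rewrite dot_sumr; elim/big_rec2: _ => [|i a y _ IH].
    by rewrite linear0 incl0 lie_br0l (_ : (0 +i* 0)%C = 0) ?scale0r.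
  rewrite linearD inclD lie_brDl IH linearZ inclZ lie_brZl hc scalerA -scalerDl dotZr.
  have /= -> := hr (cast_ord (esym (size_tuple _)) i).
  by congr (_ *: _); simpc.
have rH0 : dot r H = 0.
  have [->|r0] := eqVneq r 0; first by rewrite dot0l.
  by apply: rH; split => //; exists e.
have [z _ eE] := memv_imgP eT.
move: (rE H); rewrite rH0 (_ : (0 +i* 0)%C = 0) // scale0r.
rewrite {1}eE adE => /ad_sq_eq0; rewrite -adE -eE => e0'.
by rewrite e0' eqxx in e0.
Qed.

End RootsSpan.

(** * Root lattices *)

Section Subgroups.
Variables (V : zmodType).
Implicit Types G : set V.

Lemma subgroupN G x : is_subgroup G -> G x -> G (- x).
Proof. by move=> [G0 GB] Gx; rewrite -sub0r; exact: GB. Qed.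

Lemma subgroupD G x y : is_subgroup G -> G x -> G y -> G (x + y).
Proof. by move=> Gs Gx Gy; rewrite -[y]opprK; apply: Gs.2 => //; exact: subgroupN. Qed.

Lemma subgroup_mulz G x (z : int) : is_subgroup G -> G x -> G (x *~ z).
Proof.
move=> Gs Gx; have GN n : G (x *+ n).
  by elim: n => [|n IHn]; [exact: Gs.1 | rewrite mulrS; exact: subgroupD].
case: z => n; first exact: GN.
by rewrite NegzE mulrNz; apply: subgroupN => //; exact: GN.
Qed.

Lemma subgroup_sum G (J : Type) (r : seq J) (P : pred J) (f : J -> V) :
  is_subgroup G -> (forall j, P j -> G (f j)) -> G (\sum_(j <- r | P j) f j).
Proof.
by move=> Gs Gf; elim/big_ind: _ => //; [exact: Gs.1 | move=> x y; exact: subgroupD].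
Qed.

Lemma mem_zspan (S : set V) x : S x -> zspan S x.
Proof. by move=> Sx G _; apply. Qed.

End Subgroups.

(** The rows of P generate the same lattice as those of M: in M = L D T, they are the first n rows
    of D T. They may be dependent; where it is used, completeness of the resulting family settles
    independence. *)
Lemma row_lattice_basis m n (M : 'M[int]_(m, n)) : (n <= m)%N ->
  exists (P : 'M[int]_n) (A : 'M[int]_(m, n)) (B : 'M[int]_(n, m)),
    M = A *m P /\ P = B *m M.
Proof.
move=> nm; have [L Lu [T _ [d _ ME]]] := int_Smith_normal_form M.
set D := \matrix_(i, j) _ in ME.
pose D' : 'M[int]_n := \matrix_(i, j) (d`_i *+ (i == j)).
pose J : 'M[int]_(m, n) := \matrix_(i, j) ((i == j :> nat)%:R).
have JD : D = J *m D'.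
  apply/matrixP => i j; rewrite !mxE (bigD1 j) //= !mxE eqxx mulr1n big1.
    by rewrite addr0; case: eqP => [->|]; rewrite ?mulr0n ?mul0r ?mul1r.
  by move=> k kj; rewrite !mxE (negbTE kj) mulr0n mulr0.
have JD' : D' = J^T *m D.
  apply/matrixP => i j; rewrite !mxE (bigD1 (widen_ord nm i)) //= !mxE /= eqxx mul1r big1.
    by rewrite addr0.
  move=> k ki; rewrite !mxE (_ : (k == i :> nat) = false) ?mul0r //.
  by apply: contraNF ki => /eqP ki; apply/eqP/val_inj.
exists (D' *m T), (L *m J), (J^T *m invmx L).
by rewrite ME {1}JD JD' !mulmxA mulmxKV.
Qed.

Section RootLattices.
Variables (R : realType) (g : simpleDatum R).
Local Notation t := (tor g).
Local Notation n := (\dim {:t}).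

Lemma nat_comb_dot0 (b : seq t) x H : nat_comb b x ->
  (forall a, a \in b -> dot a H = 0) -> dot x H = 0.
Proof.
move=> [c ->] h; rewrite dot_suml big_seq big1 // => a ab.
by rewrite -scaler_nat dotZl h // mulr0.
Qed.

(** Every root is, up to sign, a combination of the base, so a vector orthogonal to the base is
    orthogonal to all roots and vanishes. *)
Lemma base_basis : basis_of {:t} (base g).
Proof.
have [fb _ bb] := base_is_base g.
rewrite basisEfree fb subvf /=; apply: (@dim_le_complete R g _ (fun i => (base g)`_i)).
move=> H h; apply: roots_separate => r /bb.
have h' a : a \in base g -> dot a H = 0.
  by move=> ab; have := h (Ordinal (etrans (index_mem a _) ab)); rewrite dotC /= nth_index.
case=> [/nat_comb_dot0/(_ h')//|/nat_comb_dot0/(_ h')].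
by rewrite dotNl => /eqP; rewrite oppr_eq0 => /eqP.
Qed.

Lemma size_base : size (base g) = n.
Proof. exact/esym/(size_basis (X := in_tuple _))/base_basis. Qed.

Definition coroot_lattice : set t := zspan [set coroot r | r in @is_root R g].

(** In the basis d dual to the base, coroots have integer coordinates, namely their pairings with
    base roots. Reducing the matrix of these coordinates yields n generators q. *)
Lemma exists_coroot_basis : exists q : 'I_n -> t,
  [/\ complete q, forall i, coroot_lattice (q i)
    & forall r, is_root r -> exists c : 'I_n -> int, coroot r = \sum_i (c i)%:~R *: q i].
Proof.
have [rs rsE] : exists rs : seq t, forall r, is_root r <-> r \in rs.
  have /finite_seqP[rs rsE] := root_finite g; exists rs => r.
  by rewrite (_ : is_root r = [set` rs] r) // -rsE.
have [_ broot _] := base_is_base g.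
(* Prepending the base makes it evident that the matrix has at least n rows. *)
pose s := base g ++ rs; pose m := size s.
have sroot (i : 'I_m) : is_root s`_i.
  have : s`_i \in s by rewrite mem_nth.
  by rewrite mem_cat => /orP[/broot|/rsE].
have bc : complete (fun i : 'I_n => (base g)`_i).
  move=> H h; apply: (basis_complete base_basis) => i.
  exact: (h (cast_ord size_base i)).
have /choice[d hd] (k : 'I_n) : exists d, forall i : 'I_n, dot d (base g)`_i = (k == i)%:R.
  exact: dot_solve.
have /choice[M0 hM0] (i : 'I_m) : exists c : 'I_n -> int,
    forall j : 'I_n, dot (coroot s`_i) (base g)`_j = (c j)%:~R.
  suff /choice[c hc] (j : 'I_n) : exists z : int, dot (coroot s`_i) (base g)`_j = z%:~R.
    by exists c.
  apply/intrP; rewrite dotC; apply: root_dot_int => //; apply: broot.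
  by rewrite mem_nth // size_base.
have nm : (n <= m)%N by rewrite /m size_cat size_base leq_addr.
have [P [A [B [MA PB]]]] := row_lattice_basis (\matrix_(i, j) M0 i j) nm.
pose q k := \sum_j (P k j)%:~R *: d j.
have corE (i : 'I_m) : coroot s`_i = \sum_j (M0 i j)%:~R *: d j.
  rewrite {1}(dual_expansion bc hd (coroot s`_i)).
  by apply: eq_bigr => j _; rewrite hM0.
have corq (i : 'I_m) : coroot s`_i = \sum_k (A i k)%:~R *: q k.
  under eq_bigr do rewrite /q scaler_sumr.
  rewrite exchange_big corE /=; apply: eq_bigr => j _.
  under eq_bigr do rewrite scalerA.
  rewrite -scaler_suml; congr (_ *: _).
  move/matrixP/(_ i j): MA; rewrite !mxE => ->.
  by rewrite rmorph_sum; apply: eq_bigr => k _; rewrite rmorphM.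
have rcor r : is_root r -> exists c : 'I_n -> int, coroot r = \sum_i (c i)%:~R *: q i.
  move=> /rsE rrs; have ri : (index r s < m)%N by rewrite index_mem mem_cat rrs orbT.
  exists (A (Ordinal ri)); rewrite -corq /= nth_index //.
  by rewrite mem_cat rrs orbT.
exists q; split=> //.
  move=> H h; apply: roots_separate => r rr.
  have [c cE] := rcor r rr; have [r0 _] := rr.
  have : dot (coroot r) H = 0.
    by rewrite cE dot_suml big1 // => i _; rewrite dotZl dotC h mulr0.
  rewrite /coroot dotZl => /eqP; rewrite mulf_eq0 mulf_eq0 pnatr_eq0 invr_eq0.
  by rewrite (gt_eqF (dot_gt0 r0)) => /eqP.
move=> k; have -> : q k = \sum_(i < m) (coroot s`_i) *~ B k i.
  rewrite /q; under [RHS]eq_bigr do rewrite corE -scaler_int scaler_sumr.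
  rewrite exchange_big /=; apply: eq_bigr => j _.
  under eq_bigr do rewrite scalerA.
  rewrite -scaler_suml; congr (_ *: _).
  move/matrixP/(_ k j): PB; rewrite !mxE => ->.
  by rewrite rmorph_sum; apply: eq_bigr => i _; rewrite rmorphM mxE.
apply: subgroup_sum; first exact: zspan_subgroup.
move=> i _; apply: (subgroup_mulz _ (zspan_subgroup _)).
by apply: mem_zspan; exists s`_i.
Qed.

Lemma weight_coroot_int (k : weight g) x : coroot_lattice x -> dot (wval k) x \is a Num.int.
Proof.
move=> /(_ [set x | dot (wval k) x \is a Num.int]); apply; first split => /=.
- by rewrite dot0r.
- by move=> u v /= hu hv; rewrite dotBr rpredB.
by move=> _ [r rr <-] /=; have /asboolP := wvalP k; apply.
Qed.

Lemma dual_lattice_bases : exists (q : 'I_n -> t) (w : 'I_n -> weight g),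
  [/\ forall i, coroot_lattice (q i),
      forall i j, dot (wval (w i)) (q j) = (i == j)%:R,
      complete q & complete (fun i => wval (w i))].
Proof.
have [q [cq qQ rq]] := exists_coroot_basis.
have /choice[d hd] (k : 'I_n) : exists d, forall i : 'I_n, dot d (q i) = (k == i)%:R.
  exact: dot_solve.
have dw k : d k \in in_weight_lattice (g := g).
  apply/asboolP => r /rq[c ->]; rewrite dot_sumr.
  by apply: rpred_sum => i _; rewrite dotZr hd rpredM ?rpred_nat // rpred_int.
exists q, (fun k => Weight (dw k)); split=> //.
exact: dual_complete cq hd.
Qed.

End RootLattices.

(** * The lattice spanned by the orbit of the highest root, and the number n_c *)

Section LevelLattice.
Variables (R : realType) (g : simpleDatum R) (l : nat).
Local Notation t := (tor g).
Implicit Types r x : t.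
Local Notation n := (\dim {:t}).

Definition rplus_orbit : set t := [set th (rplus g) | th in @weyl R g].

Lemma refl_rplus_orbit r x : is_root r -> rplus_orbit x -> rplus_orbit (refl r x).
Proof.
move=> rr [th hth <-]; exists (refl r \o th)%VF; first exact: weyl_refl.
by rewrite comp_lfunE.
Qed.

Lemma refl_Ra r x : is_root r -> Ra x -> Ra (refl r x).
Proof.
move=> rr /(_ [set x | Ra (refl r x)]); apply.
  split=> /= [|u v hu hv]; first by rewrite linear0; exact: (zspan_subgroup _).1.
  by rewrite linearB; apply: (zspan_subgroup _).2.
by move=> u hu /=; apply: mem_zspan; exact: refl_rplus_orbit.
Qed.

Lemma in_weight_latticeP x :
  reflect (forall r, is_root r -> dot x (coroot r) \is a Num.int)
          (x \in in_weight_lattice (g := g)).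
Proof. exact: asboolP. Qed.

Lemma refl_weight_lattice r x : is_root r ->
  x \in in_weight_lattice (g := g) -> refl r x \in in_weight_lattice (g := g).
Proof.
move=> rr /in_weight_latticeP hx; apply/in_weight_latticeP => r' rr'.
rewrite refl_dot reflE dotBr (dotZr (dot r (coroot r'))).
apply: rpredB; first exact: hx.
by apply: rpredM; [exact: root_dot_int | exact: hx].
Qed.

Lemma rplus_root : is_root (rplus g).
Proof. exact: (rplus_highest g).1. Qed.

Lemma root_weight_lattice r : is_root r -> r \in in_weight_lattice (g := g).
Proof. by move=> rr; apply/in_weight_latticeP => r' rr'; exact: root_dot_int. Qed.

Lemma rplus_orbit_weight x : rplus_orbit x -> x \in in_weight_lattice (g := g).
Proof.
move=> [th hth <-]; elim: hth => [|r th' rr _ IH].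
  by rewrite id_lfunE; apply: root_weight_lattice; exact: rplus_root.
by rewrite comp_lfunE; exact: refl_weight_lattice.
Qed.

(** Let S be the span of a maximal free part of the orbit; it is stable under reflections. If a base
    root lay outside S, the part of the highest root carried by such base roots would be both in S
    and orthogonal to S, hence zero, although its coefficients there are positive. *)
Lemma rplus_orbit_basis : exists s : seq t,
  basis_of {:t} s /\ forall x, x \in s -> rplus_orbit x.
Proof.
pose P k := `[< exists s : seq t, [/\ free s, forall x, x \in s -> rplus_orbit x & size s = k] >].
have exP : exists k, P k.
  by exists 0%N; apply/asboolP; exists [::]; split; rewrite ?nil_free.
have leP k : P k -> (k <= n)%N by move=> /asboolP[s [fs _ <-]]; exact: size_free_le.
case: (ex_maxnP exP leP) => k /asboolP[s [fs sO ks]] kmax; exists s; split=> //.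
have Os x : rplus_orbit x -> x \in << s >>%VS.
  move=> Ox; apply: contraT => xs; have := kmax k.+1; rewrite ltnn; apply.
  apply/asboolP; exists (x :: s); split; rewrite /= ?ks //; first by rewrite free_cons xs.
  by move=> y; rewrite inE => /orP[/eqP->|/sO].
have refl_s r v : is_root r -> v \in << s >>%VS -> refl r v \in << s >>%VS.
  move=> rr /(coord_span (X := in_tuple s)) ->; rewrite linear_sum.
  apply: memv_suml => i _; rewrite linearZ; apply: memvZ; apply: Os.
  by apply: refl_rplus_orbit => //; apply: sO; rewrite mem_nth.
have [fb broot _] := base_is_base g; have [_ rmax] := rplus_highest g.
(* For u in S the difference u - [refl a u] is a multiple of a lying in S, so it must vanish. *)
have dich a : a \in base g -> a \notin << s >>%VS -> forall u, u \in << s >>%VS -> dot a u = 0.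
  move=> /broot ra as0 u us; apply: contraNeq as0 => au.
  have : u - refl a u \in << s >>%VS by rewrite rpredB // refl_s.
  rewrite -dot_coroot_refl opprB addrC subrK => h.
  have c0 : dot u (coroot a) != 0.
    rewrite /coroot dotZr dotC mulf_neq0 // mulf_neq0 ?pnatr_eq0 //.
    by rewrite invr_eq0 gt_eqF // dot_gt0 //; case: ra.
  by rewrite -[a]scale1r -(mulVf c0) -scalerA memvZ.
have bs a : a \in base g -> a \in << s >>%VS.
  move=> ab; apply: contraT => as0; have [c cE] := rmax a (broot a ab).
  (* The components of [rplus g] along base roots outside S. The extra b at b = a comes from
     [rplus g] = a + sum c_b b, and makes the coefficient c_a + 1 nonzero. *)
  pose y := \sum_(b <- base g | b \notin << s >>%VS) (b *+ c b + b *+ (b == a)).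
  have ub : uniq (base g) by exact: free_uniq.
  have yE : y = rplus g - \sum_(b <- base g | b \in << s >>%VS) b *+ c b.
    rewrite /y big_split /=.
    have -> : \sum_(b <- base g | b \notin << s >>%VS) b *+ (b == a) = a.
      rewrite -big_filter (bigD1_seq a) ?filter_uniq //=; last by rewrite mem_filter as0.
      by rewrite eqxx mulr1n big1 ?addr0 // => b /negbTE ->; rewrite mulr0n.
    have -> : rplus g = a + \sum_(b <- base g) b *+ c b by rewrite -cE addrC subrK.
    rewrite [in RHS](bigID (mem << s >>%VS)) /= [in RHS]addrCA [RHS]addrAC.
    by rewrite subrr add0r addrC.
  have ys : y \in << s >>%VS.
    rewrite yE rpredB //; last by apply: rpred_sum => b bs; rewrite rpredMn.
    by apply: Os; exists \1%VF; [exact: weyl_id | rewrite id_lfunE].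
  have y0 : y = 0.
    apply: dot_eq0; rewrite {1}/y dot_suml big_seq_cond big1 // => b /andP[bb bs0].
    by rewrite -mulrnDr -scaler_nat dotZl (dich b bb bs0 _ ys) mulr0.
  have bc := basis_complete (base_basis g).
  have [d hd] := dot_solve (fun i : 'I_(size (base g)) => ((base g)`_i == a)%:R : R) bc
    (esym (size_base g)).
  have hd' b : b \in base g -> dot d b = (b == a)%:R.
    by move=> bb; have /= := hd (Ordinal (etrans (index_mem b _) bb)); rewrite nth_index.
  have : dot d y = (c a + 1)%:R.
    rewrite /y dot_sumr -big_filter (bigD1_seq a) ?filter_uniq //=; last by rewrite mem_filter as0.
    rewrite eqxx -mulrnDr -scaler_nat dotZr hd' // eqxx mulr1 big_seq_cond big1 ?addr0 // => b.
    rewrite mem_filter => /andP[/andP[_ bb] /negbTE ba].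
    by rewrite -mulrnDr -scaler_nat dotZr hd' // ba mulr0.
  by rewrite y0 dot0r => /esym/eqP; rewrite addn1 pnatr_eq0.
rewrite basisEfree fs subvf /= -(span_basis (base_basis g)).
have /dimvS/leq_trans : (<<base g>> <= << s >>)%VS by apply/span_subvP.
by apply; rewrite dim_span.
Qed.

(** N is |det B|, where B expresses a basis taken from the orbit in the dual basis of weights: by
    Cramer's rule det B times each w_j is an integer combination of orbit elements. *)
Lemma Ra_finite_exponent : exists N : nat, (0 < N)%N /\
  forall k : weight g, Ra (wval k *+ N).
Proof.
have [q [w [qQ wq cq cw]]] := dual_lattice_bases g.
have [s [bs sO]] := rplus_orbit_basis.
have sn : size s = n by exact/esym/(size_basis (X := in_tuple _)).
have sOi (i : 'I_n) : rplus_orbit s`_i by apply: sO; rewrite mem_nth ?sn.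
have /choice[B0 hB] (i : 'I_n) : exists c : 'I_n -> int,
    forall j, dot s`_i (q j) = (c j)%:~R.
  suff /choice[c hc] (j : 'I_n) : exists z : int, dot s`_i (q j) = z%:~R by exists c.
  apply/intrP; exact: (@weight_coroot_int _ _ (Weight (rplus_orbit_weight (sOi i)))).
pose B : 'M[int]_n := \matrix_(i, j) B0 i j.
have sE (i : 'I_n) : s`_i = \sum_j (B i j)%:~R *: wval (w j).
  rewrite {1}(dual_expansion cq wq s`_i).
  by apply: eq_bigr => j _; rewrite hB mxE.
have B0' : \det B != 0.
  apply/negP => /eqP dB; have : \det (map_mx (intr : int -> R) B) == 0.
    by rewrite det_map_mx dB rmorph0.
  move=> /det0P[v v0 vB]; move/eqP: v0; apply; apply/rowP => i; rewrite mxE.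
  have /freeP fs : free (in_tuple s) := basis_free bs.
  have := fs (fun i => v 0 (cast_ord sn i)).
  move=> /(_ _ (cast_ord (esym sn) i)); rewrite cast_ordKV; apply.
  rewrite (reindex (cast_ord (esym sn))) /=; last first.
    by apply: onW_bij; exists (cast_ord sn); [exact: cast_ordKV | exact: cast_ordK].
  under eq_bigr do rewrite cast_ordKV (sE _) scaler_sumr.
  rewrite exchange_big big1 // => j _ /=.
  under eq_bigr do rewrite scalerA.
  rewrite -scaler_suml; move/rowP/(_ j): vB; rewrite !mxE => h.
  rewrite (_ : \sum_i _ = 0) ?scale0r // -[RHS]h.
  by apply: eq_bigr => k _; rewrite !mxE.
have detw j : Ra (g := g) (wval (w j) *~ \det B).
  have -> : wval (w j) *~ \det B = \sum_i s`_(i : 'I_n) *~ (\adj B) j i.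
    under eq_bigr do rewrite sE -scaler_int scaler_sumr.
    rewrite exchange_big /=.
    under eq_bigr do under eq_bigr do rewrite scalerA -rmorphM.
    under eq_bigr do rewrite -scaler_suml -rmorph_sum.
    have adjE k : \sum_i \adj B j i * B i k = \det B *+ (j == k).
      by have /matrixP/(_ j k) := mul_adj_mx B; rewrite !mxE.
    under eq_bigr do rewrite adjE.
    rewrite (bigD1 j) //= eqxx mulr1n scaler_int big1 ?addr0 // => k jk.
    by rewrite eq_sym (negbTE jk) mulr0n scale0r.
  apply: (subgroup_sum _ (zspan_subgroup _)) => i _.
  by apply: (subgroup_mulz _ (zspan_subgroup _)); exact: (mem_zspan (sOi i)).
have detw' j : Ra (wval (w j) *+ `|\det B|%N).
  have [e|e] : (`|\det B|%N : int) = \det B \/ (`|\det B|%N : int) = - \det B.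
    by rewrite abszE; case: (leP 0 (\det B)) => h; [left; exact: ger0_norm | right; exact: ltr0_norm].
  - by rewrite pmulrn e; exact: detw.
  - by rewrite pmulrn e mulrNz; exact: (subgroupN (zspan_subgroup _) (detw j)).
exists `|\det B|%N; split; first by rewrite absz_gt0.
move=> k; have /choice[c hc] j : exists z : int, dot (wval k) (q j) = z%:~R.
  by apply/intrP; exact: weight_coroot_int.
rewrite (dual_expansion cq wq (wval k)) -sumrMnl.
apply: (subgroup_sum _ (zspan_subgroup _)) => j _.
rewrite hc scaler_int pmulrn -mulrzA mulrC mulrzA -pmulrn.
exact: (subgroup_mulz _ (zspan_subgroup _) (detw' j)).
Qed.

Lemma nc_nat : exists2 c : nat, nc g l = c%:R & (0 < c)%N.
Proof.
have rr := rplus_root; have [r0 _] := rr.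
have [fb broot bb] := base_is_base g; have [_ rmax] := rplus_highest g.
have /intrP[z zE] : dot (wval (rho g)) (coroot (rplus g)) \is a Num.int.
  by have /in_weight_latticeP := wvalP (rho g); apply.
suff z0 : 0 <= dot (wval (rho g)) (coroot (rplus g)).
  move: z0; rewrite /nc /dual_coxeter zE; case: z {zE} => z.
    by move=> _; exists (1 + z + l)%N; rewrite ?natrD // -addnA.
  by rewrite NegzE mulrNz oppr_ge0 -pmulrn lern0.
have [a ab] : exists a, a \in base g.
  case Eb : (base g) => [|a b]; last by exists a; rewrite mem_head.
  have nil0 x : nat_comb (base g) x -> x = 0 by rewrite Eb => -[c ->]; rewrite big_nil.
  have [/nil0 h|/nil0/eqP] := bb _ rr; first by rewrite h eqxx in r0.
  by rewrite oppr_eq0 (negbTE r0).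
(* Comparison with a base root shows that [rplus g] is a nonnegative combination of the base; [bb]
   alone leaves its sign open. *)
have [c cE] := rmax a (broot a ab).
have rE : rplus g = a + \sum_(b <- base g) b *+ c b by rewrite -cE addrC subrK.
have fund w : fundamental w -> 0 <= dot (wval w) (coroot (rplus g)).
  move=> [a0 _ hw]; rewrite /coroot dotZr rplus_norm divff ?pnatr_eq0 // mul1r.
  have hw' b : b \in base g -> 0 <= dot (wval w) b.
    move=> bb'; have := hw b bb'; rewrite /coroot dotZr => h.
    have b0 : 0 < dot b b by apply: dot_gt0; case: (broot b bb').
    have : 0 <= 2 / dot b b * dot (wval w) b by rewrite h.
    by rewrite pmulr_rge0 // divr_gt0.
  rewrite rE dotDr; apply: addr_ge0; first exact: hw'.
  rewrite dot_sumr big_seq; apply: sumr_ge0 => b bb'.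
  by rewrite -scaler_nat dotZr mulr_ge0 // hw'.
have wvalD : {morph @wval R g : x y / x + y} by [].
rewrite /rho (big_morph _ wvalD (erefl : wval (0 : weight g) = 0)).
rewrite dot_suml big_seq; apply: sumr_ge0 => w.
by case: finite_supportP => // X XP _ _ /XP/fund.
Qed.

End LevelLattice.

(** * The pairing of weights with the torus *)

Section Cis.
Variable R : realType.
Implicit Types a b : R.

Lemma cisD a b : cis (a + b) = cis a * cis b.
Proof. by rewrite /cis cosD sinD; simpc; congr (_ +i* _)%C; rewrite addrC. Qed.

Lemma cis0 : cis (0 : R) = 1.
Proof. by rewrite /cis cos0 sin0. Qed.

Lemma cis_unit a : cis a * cis (- a) = 1.
Proof. by rewrite -cisD subrr cis0. Qed.

Lemma cis_neq0 a : cis a != 0.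
Proof.
by apply/eqP => h; have /eqP := cis_unit a; rewrite h mul0r eq_sym oner_eq0.
Qed.

Lemma cisN a : cis (- a) = (cis a)^-1.
Proof. by apply: (mulfI (cis_neq0 a)); rewrite cis_unit divff // cis_neq0. Qed.

Lemma cisMn a m : cis (a *+ m) = cis a ^+ m.
Proof. by elim: m => [|m IH]; rewrite ?cis0 // mulrS cisD IH exprS. Qed.

Lemma cis_2pi : cis (2 * pi : R) = 1.
Proof. by rewrite mulr_natl /cis cos2pi sin2pi. Qed.

Lemma cis_int (z : int) : cis (2 * pi * z%:~R : R) = 1.
Proof.
have cisn m : cis (2 * pi * m%:R : R) = 1.
  by rewrite mulr_natr cisMn cis_2pi expr1n.
case: z => m; first exact: cisn.
by rewrite NegzE mulrNz mulrN cisN cisn invr1.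
Qed.

Lemma cis_eq1 a : cis a = 1 -> exists z : int, a = 2 * pi * z%:~R.
Proof.
have p0 : 0 < 2 * pi :> R by rewrite mulr_gt0 // pi_gt0.
move=> ca; exists (Num.floor (a / (2 * pi))); set z := Num.floor _.
pose b := a - 2 * pi * z%:~R.
have /andP[za az] := floor_itv (a / (2 * pi)).
have b0 : 0 <= b by rewrite /b subr_ge0 mulrC -ler_pdivlMr.
have b2 : b < 2 * pi.
  by rewrite /b ltrBlDr; move: az; rewrite ltr_pdivrMr // intrD mulrDl mul1r -/z [z%:~R * _]mulrC addrC.
have : cis b = 1 by rewrite /b cisD cisN cis_int ca invr1 mulr1.
case=> cb _; have hb : b = (b / 2) *+ 2 by rewrite -mulr_natr divfK ?pnatr_eq0.
have [h0|h0] := eqVneq b 0.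
  by apply/eqP; rewrite -subr_eq0; apply/eqP.
(* From cos b = 1 one gets cos^2 (b/2) = 1, hence sin (b/2) = 0, which is impossible for 0 < b/2 <
   pi. *)
have : 0 < sin (b / 2).
  apply: sin_gt0_pi; apply/andP; split; last by rewrite ltr_pdivrMr // mulrC.
  by rewrite divr_gt0 // lt_def h0.
rewrite lt_def => /andP[/negP[]]; rewrite -sqrf_eq0 sin2cos2 subr_eq0 eq_sym.
have := cos_mulr2n (b / 2); rewrite -hb cb => h.
by apply/eqP; lra.
Qed.

End Cis.

Section Torus.
Variables (R : realType) (g : simpleDatum R).
Local Notation t := (tor g).
Implicit Types (k s : weight g) (x y : T g) (H : t).

Lemma expT_repr x : expT (repr x) = x.
Proof. exact: reprK. Qed.

Lemma expT_eq H H' : expT H = expT H' <-> H - H' \in exp_kernel (g := g).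
Proof.
have := Quotient.idealrBE (exp_kernel (g := g) : zmodClosed t) H H' => ->.
by split=> /eqP.
Qed.

Lemma expTD H H' : expT (H + H') = expT H + expT H'.
Proof. exact: raddfD. Qed.

Definition chiT k x : R[i] := cis (dot (wval k) (repr x)).

(** Two representatives differ by 2 pi times an element of the coroot lattice, on which weights are
    integral. *)
Lemma chiT_expT k H : chiT k (expT H) = cis (dot (wval k) H).
Proof.
have /expT_eq/asboolP[u /weight_coroot_int-/(_ k)/intrP[z uz] rE] := expT_repr (expT H).
rewrite /chiT -[repr _](subrK H) rE dotDr dotZr uz cisD cis_int mul1r.
by [].
Qed.

Lemma chiTDr k x y : chiT k (x + y) = chiT k x * chiT k y.
Proof.
rewrite -{1}(expT_repr x) -{1}(expT_repr y) -expTD chiT_expT dotDr cisD.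
by [].
Qed.

Lemma chiTDl k k' x : chiT (k + k') x = chiT k x * chiT k' x.
Proof. by rewrite /chiT dotDl cisD. Qed.

Lemma chiT0l x : chiT 0 x = 1.
Proof. by rewrite /chiT dot0l cis0. Qed.

Lemma chiT0r k : chiT k 0 = 1.
Proof. by rewrite (_ : 0 = expT 0) ?chiT_expT ?dot0r ?cis0 //; rewrite [RHS]raddf0. Qed.

Lemma chiT_neq0 k x : chiT k x != 0.
Proof. exact: cis_neq0. Qed.

Lemma chiTNl k x : chiT (- k) x = (chiT k x)^-1.
Proof.
by apply: (mulfI (chiT_neq0 k x)); rewrite -chiTDl subrr chiT0l divff ?chiT_neq0.
Qed.

Lemma chiTNr k x : chiT k (- x) = (chiT k x)^-1.
Proof.
by apply: (mulfI (chiT_neq0 k x)); rewrite -chiTDr subrr chiT0r divff ?chiT_neq0.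
Qed.

Lemma chiTMn k m x : chiT (k *+ m) x = chiT k x ^+ m.
Proof. by elim: m => [|m IH]; rewrite ?chiT0l // mulrS chiTDl IH exprS. Qed.

(** The coordinates of [repr x] / (2 pi) in the coroot basis q are its pairings with the dual
    weights w, integers by [cis_eq1]. *)
Lemma chiT_sep x : (forall k, chiT k x = 1) -> x = 0.
Proof.
have [q [w [qQ wq cq cw]]] := dual_lattice_bases g.
move=> x1; rewrite -(expT_repr x) (_ : 0 = expT 0); last by rewrite [RHS]raddf0.
have p0 : 2 * pi != 0 :> R by rewrite mulf_neq0 ?pnatr_eq0 // gt_eqF // pi_gt0.
apply/expT_eq/asboolP; rewrite subr0; exists ((2 * pi)^-1 *: repr x); last first.
  by rewrite scalerA divff // scale1r.
have qw i j : dot (q i) (wval (w j)) = (i == j)%:R by rewrite dotC wq eq_sym.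
rewrite (dual_expansion cw qw (_ *: _)).
apply: (subgroup_sum _ (zspan_subgroup _)) => i _.
have [z zE] := cis_eq1 (x1 (w i)); rewrite dotZl (dotC (repr x)) zE mulKf // scaler_int.
exact: (subgroup_mulz _ (zspan_subgroup _) (qQ i)).
Qed.

(** From here on T_A is used as the annihilator of A under the pairing [chiT]. *)
Lemma TAP l (A : set (Wl g l)) x : TA A x <-> forall k, A (piW l k) -> chiT k x = 1.
Proof.
split=> [[H HA <-] k /HA/intrP[z kz]|x1].
  by rewrite chiT_expT dotZr kz cis_int.
have p0 : 2 * pi != 0 :> R by rewrite mulf_neq0 ?pnatr_eq0 // gt_eqF // pi_gt0.
exists ((2 * pi)^-1 *: repr x); last by rewrite scalerA divff // scale1r expT_repr.
move=> k Ak /=; have [z zE] := cis_eq1 (x1 k Ak).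
by rewrite dotZr zE mulKf //; apply/intrP; exists z.
Qed.

Lemma piWE l k : (piW l k = 0) <-> k \in in_nc_Ra (g := g) l.
Proof.
have := Quotient.idealrBE (in_nc_Ra (g := g) l : zmodClosed (weight g)) k 0.
have <- : piW l (0 : weight g) = 0 by exact: raddf0.
by rewrite subr0 => ->; split=> /eqP.
Qed.

Lemma piWD l k k' : piW l (k + k') = piW l k + piW l k'.
Proof. exact: raddfD. Qed.

Lemma piWN l k : piW l (- k) = - piW l k.
Proof. exact: raddfN. Qed.

Lemma piW_repr l (a : Wl g l) : piW l (repr a) = a.
Proof. exact: reprK. Qed.

Lemma TlP l x : Tl l x <-> forall k, k \in in_nc_Ra (g := g) l -> chiT k x = 1.
Proof.
rewrite /Tl; split=> [/TAP h k /piWE k0|h]; first exact: h.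
by apply/TAP => k /= /piWE; exact: h.
Qed.

End Torus.

(** * Multiplicities, characters and the Weyl group *)

Section Multiplicities.
Variables (R : realType) (g : simpleDatum R) (l : nat).
Local Notation t := (tor g).
Implicit Types (k s w : weight g) (x y : T g) (H : t).

Lemma mult_has_weight w s : mult w s != 0%N -> has_weight (irrep w) (wval s).
Proof.
rewrite /mult; have [U hU] := lin_closed_vspace (lin_closed_wv (irrep w) (wval s)).
rewrite (fdim_vspace hU) dimv_eq0 => U0.
by exists (vpick U); [apply/hU; exact: memv_pick | rewrite vpick0].
Qed.

(** Replaces the sums over all weights in [chi] and [Delta] by sums over a single list. *)
Lemma mult_support w : exists q : seq (weight g),
  uniq q /\ forall s, s \notin q -> mult w s = 0%N.
Proof.
have fin : finite_set [set s | mult w s != 0%N].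
  apply: (sub_finite_set _ (finite_preimage (f := @wval R g) _ (has_weight_finite (irrep w)))).
    by move=> s /mult_has_weight.
  by move=> s s' _ _; exact: val_inj.
have [q qE] := (finite_seqP _).1 fin.
exists (undup q); split=> [|s]; first exact: undup_uniq.
rewrite mem_undup => sq; apply/eqP; apply: contraNT sq => ms.
by have : [set` q] s by rewrite -qE.
Qed.

Lemma fsum_support (V : nmodType) (q : seq (weight g)) (f : weight g -> V) :
  uniq q -> (forall s, s \notin q -> f s = 0) ->
  \sum_(s \in [set: weight g]) f s = \sum_(s <- q) f s.
Proof.
move=> uq f0; rewrite (@fsbigE _ _ _ _ setT q) //; last by move=> s _; exact: f0.
by apply: eq_bigl => s; rewrite mem_set.
Qed.

Lemma weyl_chi w H th : weyl th -> chi w (expT (th H)) = chi w (expT H).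
Proof.
elim=> [|r {}th rr _ <-]; first by rewrite id_lfunE.
rewrite comp_lfunE; set H' := th H.
(* The reflection as a permutation of the weight lattice; the default of [insubd] is never taken
   because reflections preserve the lattice. *)
pose h s : weight g := insubd s (refl r (wval s)).
have hE s : wval (h s) = refl r (wval s).
  by rewrite [LHS]val_insubd (refl_weight_lattice rr (wvalP s)).
have hK : involutive h.
  by move=> s; apply: val_inj; rewrite [LHS]hE hE reflK //; case: rr.
rewrite /chi [RHS](reindex_fsbigT h); last exact: inv_bij.
apply: eq_fsbigr => s _; congr (_ * _); first by rewrite /mult hE fdim_wv_refl.
by have := chiT_expT (h s) H'; rewrite /chiT => ->; rewrite [LHS]chiT_expT hE refl_dot.
Qed.

Lemma weyl_Tl H th : weyl th -> Tl l (expT H) -> Tl l (expT (th H)).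
Proof.
elim=> [|r {}th rr _ IH] TlH; first by rewrite id_lfunE.
move/TlP: (IH TlH) => {}IH; apply/TlP => k /asboolP[a ha ka].
rewrite comp_lfunE chiT_expT -refl_dot.
have := IH (Weight (refl_weight_lattice rr (wvalP k))); rewrite chiT_expT /=; apply.
by apply/asboolP; exists (refl r a); [exact: refl_Ra | rewrite /= ka linearZ].
Qed.

Lemma in_nc_Ra_exponent : exists2 N : nat, (0 < N)%N &
  forall k, k *+ N \in in_nc_Ra (g := g) l.
Proof.
have [N [N0 hN]] := Ra_finite_exponent g; have [c cE c0] := nc_nat g l.
exists (N * c)%N; first by rewrite muln_gt0 N0.
move=> k; apply/asboolP; exists (wval k *+ N); first exact: hN.
rewrite cE scaler_nat -mulrnA.
by elim: (N * c)%N => [//|m IH]; rewrite !mulrS -IH.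
Qed.

End Multiplicities.

(** * Fourier analysis on the quantum root space *)

Section FiniteOrder.
Variables (R : realType) (E : lmodType R[i]) (tau : E -> E) (U : set E).
Hypotheses (tau_lin : linear tau) (UL : lin_closed U).
Hypothesis tauU : forall f, U f -> U (tau f).

Definition root1 (N a : nat) : R[i] := cis (2 * pi * (a%:R / N%:R)).

Lemma root1X N a : (0 < N)%N -> root1 N a ^+ N = 1.
Proof.
move=> N0; rewrite -cisMn -mulrnAr -[_ *+ N]mulr_natr mulfVK ?pnatr_eq0 -?lt0n //.
exact: (cis_int R a).
Qed.

Lemma sum_root1 N m : (m < N)%N -> \sum_(a < N) (root1 N a ^+ m)^-1 = (N *+ (m == 0%N))%:R.
Proof.
move=> mN; have N0 : (0 < N)%N by exact: leq_ltn_trans mN.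
have NR : N%:R != 0 :> R by rewrite pnatr_eq0 -lt0n.
have [->|m0] := eqVneq m 0%N.
  by under eq_bigr do rewrite expr0 invr1; rewrite sumr_const card_ord mulr1n.
pose z := (root1 N m)^-1 : R[i].
have zE (a : 'I_N) : (root1 N a ^+ m)^-1 = z ^+ a.
  rewrite /z exprVn; congr (_^-1); rewrite /root1 -!cisMn; congr cis.
  by rewrite -[LHS]mulr_natr -[RHS]mulr_natr; ring.
under eq_bigr do rewrite zE.
(* z = 1 would make m a multiple of N, against 0 < m < N. The geometric sum times z - 1 is z^N - 1 =
   0. *)
have z1 : z - 1 != 0.
  rewrite subr_eq0 invr_eq1; apply/eqP => /cis_eq1[a].
  have p0 : 2 * pi != 0 :> R by rewrite mulf_neq0 ?pnatr_eq0 // gt_eqF // pi_gt0.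
  move/(mulfI p0)/(canRL (mulfVK NR)).
  case: a => a; rewrite ?NegzE -?pmulrn.
    rewrite -natrM => /eqP; rewrite eqr_nat => /eqP h.
    by move: mN m0; rewrite h; case: a {h} => [|a]; rewrite ?mul0n // mulSn ltnNge leq_addr.
  rewrite mulrNz mulNr -pmulrn -natrM => /eqP; rewrite -subr_eq0 opprK -natrD pnatr_eq0.
  by rewrite addn_eq0 (negbTE m0).
apply: (mulfI z1); rewrite mulr0n mulr0 -subrX1.
by rewrite /z exprVn root1X // invr1 subrr.
Qed.

Lemma sum_shift (V : zmodType) (G : nat -> V) N : G N = G 0%N ->
  \sum_(m < N) G m.+1 = \sum_(m < N) G m.
Proof.
move=> GN; apply: (addrI (G 0%N)).
by rewrite -[LHS](big_ord_recl N (fun m => G m)) big_ord_recr /= GN addrC.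
Qed.

(** The component h_a is the discrete Fourier projection, the mean over m < N of root_a^(-m) tau^m
    f. Summed over a, orthogonality of roots of unity leaves only the term m = 0. *)
Lemma finite_order_decomposition N f : (0 < N)%N -> U f -> iter N tau f = f ->
  exists h : 'I_N -> E, [/\ forall a, U (h a),
    forall a, tau (h a) = root1 N a *: h a & f = \sum_a h a].
Proof.
move=> N0 Uf fN; have NC : N%:R != 0 :> R[i] by rewrite pnatr_eq0 -lt0n.
have Ui m : U (iter m tau f) by elim: m => //= m; exact: tauU.
exists (fun a => N%:R^-1 *: \sum_(m < N) (root1 N a ^+ m)^-1 *: iter m tau f); split.
- move=> a; apply: lin_closedZ => //; apply: lin_closed_sum => // m _.
  exact: lin_closedZ.
- move=> a; rewrite (linear_funZ tau_lin) (linear_funsum tau_lin) scalerA mulrC -scalerA.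
  congr (_ *: _); rewrite scaler_sumr.
  have r0 : root1 N a != 0 by exact: cis_neq0.
  pose G m := root1 N a *: ((root1 N a ^+ m)^-1 *: iter m tau f).
  transitivity (\sum_(m < N) G m.+1).
    apply: eq_bigr => m _; rewrite (linear_funZ tau_lin) /G /= scalerA; congr (_ *: _).
    by rewrite exprS invfM mulrA divff // mul1r.
  have GN : G N = G 0%N by rewrite /G fN root1X.
  by rewrite sum_shift.
- rewrite -scaler_sumr exchange_big /=.
  under eq_bigr do rewrite -scaler_suml sum_root1 //.
  rewrite (bigD1 (Ordinal N0)) //= big1 => [|m m0].
    by rewrite addr0 mulr1n scalerA mulVf // scale1r.
  rewrite (_ : (m == 0 :> nat) = false) ?mulr0n ?scale0r //.
  by apply: contraNF m0 => /eqP h; apply/eqP/val_inj.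
Qed.

End FiniteOrder.

Section Generation.
Variables (R : realType) (g : simpleDatum R).
Local Notation t := (tor g).
Local Notation n := (\dim {:t}).

(** Reduces an identity that is multiplicative in the weight to the dual basis w. *)
Lemma weights_generated (q : 'I_n -> t) (w : 'I_n -> weight g) (G : set (weight g)) :
  (forall i, coroot_lattice (q i)) ->
  (forall i j, dot (wval (w i)) (q j) = (i == j)%:R) -> complete q ->
  is_subgroup G -> (forall i, G (w i)) -> forall k, G k.
Proof.
move=> qQ wq cq Gs Gw k.
have /choice[c hc] j : exists z : int, dot (wval k) (q j) = z%:~R.
  by apply/intrP; exact: weight_coroot_int.
have -> : k = \sum_i w i *~ c i.
  apply: val_inj; rewrite (raddf_sum (val : weight g -> t)) [LHS](dual_expansion cq wq).
  by apply: eq_bigr => i _; rewrite hc scaler_int (raddfMz (val : weight g -> t)).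
by apply: (subgroup_sum _ Gs) => i _; apply: (subgroup_mulz _ Gs).
Qed.

End Generation.

Section TlFinite.
Variables (R : realType) (g : simpleDatum R) (l : nat).
Local Notation t := (tor g).
Local Notation n := (\dim {:t}).

(** A point of T_l is determined by its pairings with the w_i, which are N-th roots of unity, so T_l
    lies in a grid of N^n points. *)
Lemma Tl_finite : finite_set (@Tl R g l).
Proof.
have [q [w [qQ wq cq cw]]] := dual_lattice_bases g.
have [N N0 hN] := in_nc_Ra_exponent g l.
have NR : N%:R != 0 :> R by rewrite pnatr_eq0 -lt0n.
have p0 : 2 * pi != 0 :> R by rewrite mulf_neq0 ?pnatr_eq0 // gt_eqF // pi_gt0.
pose F (c : {ffun 'I_n -> 'I_N}) : T g :=
  expT (\sum_i (2 * pi * ((c i)%:R / N%:R)) *: q i).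
apply: (@sub_finite_set _ _ (F @` [set: {ffun 'I_n -> 'I_N}])); last first.
  exact/finite_image/finite_finset.
move=> x /TlP xT.
have /choice[c hc] i : exists c : 'I_N, chiT (w i) x = root1 R N c.
  have := xT _ (hN (w i)); rewrite chiTMn /chiT -cisMn => /cis_eq1[z zE].
  have Nz : (N : int) != 0 by rewrite -lt0n.
  have m0 : 0 <= (z %% N)%Z by rewrite modz_ge0.
  have mN : (absz (z %% N)%Z < N)%N.
    by rewrite -ltz_nat gez0_abs // ltz_pmod // ltz_nat.
  exists (Ordinal mN); rewrite /root1 /=.
  have -> : dot (wval (w i)) (repr x) = 2 * pi * (z%:~R / N%:R).
    by apply: (mulIf NR); rewrite mulr_natr zE -!mulrA mulVf // mulr1.
  have -> : z%:~R / N%:R = (absz (z %% N)%Z)%:R / N%:R + (z %/ N)%Z%:~R :> R.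
    rewrite {1}(divz_eq z N) intrD intrM mulrDl mulfK // addrC; congr (_ / _ + _).
    by rewrite -{1}(gez0_abs m0).
  by rewrite mulrDr cisD cis_int mulr1.
exists (finfun c) => //; apply/eqP; rewrite -subr_eq0; apply/eqP/chiT_sep => k.
pose G := [set k : weight g | chiT k (F (finfun c) - x) = 1].
apply: (@weights_generated _ _ q w G) => // {k}.
  split=> [|k k']; rewrite /G /= ?chiT0l // chiTDl chiTNl => -> ->.
  by rewrite invr1 mulr1.
move=> i; rewrite /G /= chiTDr chiTNr hc chiT_expT dot_sumr (bigD1 i) //=.
rewrite big1 => [|j ji]; last by rewrite dotZr wq eq_sym (negbTE ji) mulr0.
by rewrite dotZr wq eqxx mulr1 addr0 ffunE divff // cis_neq0.
Qed.

End TlFinite.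

(** * Plane waves and joint eigenvectors of the translations *)

Section QuantumRootSpace.
Variables (R : realType) (g : simpleDatum R) (l : nat).
Variables (Hs : vectType R[i]) (Pi : (Tl0 g l -> R[i]) -> 'End(Hs)).
Local Notation t := (tor g).
Local Notation n := (\dim {:t}).
Local Notation WL := (Wl g l).
Implicit Types (k s w : weight g) (x y : T g) (f : WL -> Hs) (A : set WL).

Definition Pi_eigenspace x : set Hs :=
  [set v | forall w, fundamental w -> Pi_fund Pi w v = chi w x *: v].

Definition A_eigenspace A x : set (WL -> Hs) :=
  [set f | root_space Pi f /\ forall j, A (piW l j) ->
    translation (piW l j) f = cis (- dot (wval j) (repr x)) *: f].

(** The inverse matches the phase e^(-i<j,H>) in [mA], and makes [Delta w], which evaluates at k -
    s, act by chi_w(y). Independence of the representative holds for y in T_l, see [wave_piW]. *)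
Definition wave y (v : Hs) : WL -> Hs := fun a => (chiT (repr a) y)^-1 *: v.

Lemma scale_funE (c : R[i]) f a : (c *: f) a = c *: f a.
Proof. by []. Qed.

Lemma lin_closed_Pi_eigenspace x : lin_closed (Pi_eigenspace x).
Proof.
split=> [w _|a u v hu hv w fw]; first by rewrite linear0 scaler0.
by rewrite linearD linearZ /= (hu w fw) (hv w fw) scalerDr !scalerA mulrC.
Qed.

Lemma chi_sum w q x : uniq q -> (forall s, s \notin q -> mult w s = 0%N) ->
  chi w x = \sum_(s <- q) (mult w s)%:R * chiT s x.
Proof.
by move=> uq q0; apply: fsum_support => // s /q0 ->; rewrite mul0r.
Qed.

Lemma Delta_sum w q f a : uniq q -> (forall s, s \notin q -> mult w s = 0%N) ->
  Delta w f a = \sum_(s <- q) (mult w s)%:R *: f (a - piW l s).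
Proof.
by move=> uq q0; apply: fsum_support => // s /q0 ->; rewrite scale0r.
Qed.

Lemma wave_piW y v k : Tl l y -> wave y v (piW l k) = (chiT k y)^-1 *: v.
Proof.
move=> /TlP yT; congr (_^-1 *: _); set k' := repr _.
have : chiT (k' - k) y = 1.
  by apply/yT/piWE; rewrite piWD piWN piW_repr subrr.
by rewrite chiTDl chiTNl => /divr1_eq.
Qed.

Lemma lin_closed_A_eigenspace A x : lin_closed (A_eigenspace A x).
Proof.
split; first split.
- move=> w _ a; have [q [uq q0]] := mult_support w.
  by rewrite (Delta_sum _ _ uq q0) big1 ?linear0 ?addr0 // => s _; rewrite scaler0.
- by move=> j _; rewrite scaler0.
move=> c f h [rf Af] [rh Ah]; split.
- move=> w fw a; have [q [uq q0]] := mult_support w.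
  have := rf w fw a; have := rh w fw a; rewrite !(Delta_sum _ _ uq q0).
  move=> /eqP; rewrite subr_eq0 => /eqP e1 /eqP; rewrite subr_eq0 => /eqP e2.
  rewrite linearD linearZ /= -e1 -e2 scaler_sumr -big_split /=; apply/eqP; rewrite subr_eq0; apply/eqP.
  by apply: eq_bigr => s _; rewrite [(c *: f + h) _]/= scalerDr !scalerA mulrC.
- by move=> j Aj; rewrite scalerDr scalerA mulrC -scalerA -(Af _ Aj) -(Ah _ Aj).
Qed.

Lemma translation_A_eigenspace A x k f :
  A_eigenspace A x f -> A_eigenspace A x (translation (piW l k) f).
Proof.
move=> [rf Af]; split=> [w fw a|j Aj].
  have [q [uq q0]] := mult_support w.
  have := rf w fw (a + piW l k); rewrite !(Delta_sum _ _ uq q0) => h.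
  by rewrite -[RHS]h; congr (_ - _); apply: eq_bigr => s _; rewrite /translation addrAC.
apply: funext => a; have := congr1 (fun f => f (a + piW l k)) (Af j Aj).
by rewrite /translation addrAC => ->.
Qed.

Lemma wave_A_eigenspace A x y v : Tl l y -> Pi_eigenspace y v ->
  (forall j, A (piW l j) -> chiT j y = chiT j x) -> A_eigenspace A x (wave y v).
Proof.
move=> yT vE yx; split=> [w fw a|j Aj].
  have [q [uq q0]] := mult_support w.
  rewrite (Delta_sum _ _ uq q0) -(piW_repr a) wave_piW // linearZ /= (vE w fw).
  rewrite (chi_sum y uq q0) scaler_suml scaler_sumr; apply/eqP; rewrite subr_eq0.
  apply/eqP/eq_bigr => s _; rewrite -piWN -piWD wave_piW // chiTDl chiTNl invfM invrK.
  by rewrite !scalerA mulrCA.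
apply: funext => a; rewrite /translation -(piW_repr a) -piWD wave_piW //.
by rewrite scale_funE wave_piW // chiTDl invfM mulrC yx // cisN scalerA.
Qed.

(** Evaluating the defining equations at the class 0, where the wave equals v, recovers both
    conditions. *)
Lemma wave_A_eigenspaceP A x y v : Tl l y -> v != 0 ->
  A_eigenspace A x (wave y v) ->
  Pi_eigenspace y v /\ forall j, A (piW l j) -> chiT j y = chiT j x.
Proof.
move=> yT v0 [rf Af]; have w0 : wave y v (piW l 0) = v.
  by rewrite wave_piW // chiT0l invr1 scale1r.
split=> [w fw|j Aj].
  have [q [uq q0]] := mult_support w.
  have := rf w fw (piW l 0); rewrite (Delta_sum _ _ uq q0) w0 => /eqP.
  rewrite subr_eq0 => /eqP <-; rewrite (chi_sum y uq q0) scaler_suml.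
  apply: eq_bigr => s _; rewrite -piWN -piWD add0r wave_piW // chiTNl invrK.
  by rewrite scalerA.
have := congr1 (fun f => f (piW l 0)) (Af j Aj).
rewrite /translation -piWD add0r wave_piW // scale_funE w0 cisN => /eqP.
rewrite -subr_eq0 -scalerBl scaler_eq0 (negbTE v0) orbF subr_eq0 => /eqP.
exact: invr_inj.
Qed.

Lemma translation_linear (a : WL) : linear (translation a : (WL -> Hs) -> WL -> Hs).
Proof. by []. Qed.

Lemma iter_translation k m f : iter m (translation (piW l k)) f =
  fun a => f (a + piW l (k *+ m)).
Proof.
elim: m => [|m IH]; apply: funext => a /=.
  by rewrite (_ : piW l 0 = 0) ?addr0 //; apply/piWE/rpred0.
by rewrite {1}/translation IH mulrS piWD addrA.
Qed.

(** The induction varies U: each step replaces it by the eigenspace of one translation in U, still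
    stable under the others because translations commute. [zspan] expresses being a finite sum of
    such h. *)
Lemma translation_decomposition N (ws : seq (weight g)) (U : set (WL -> Hs)) f :
  (0 < N)%N -> (forall k, k *+ N \in in_nc_Ra (g := g) l) ->
  lin_closed U -> (forall k f, U f -> U (translation (piW l k) f)) -> U f ->
  zspan [set h | U h /\ forall w, w \in ws ->
    exists a, translation (piW l w) h = root1 R N a *: h] f.
Proof.
move=> N0 hN; elim: ws U f => [|w ws IH] U f UL Ut Uf.
  by apply: mem_zspan; split.
have fN : iter N (translation (piW l w)) f = f.
  rewrite iter_translation; apply: funext => a.
  by rewrite (_ : piW l (w *+ N) = 0) ?addr0 //; apply/piWE.
have [h [Uh hh ->]] :=
  finite_order_decomposition (translation_linear _) UL (Ut w) N0 Uf fN.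
apply: (subgroup_sum _ (zspan_subgroup _)) => a _ G Gs GS.
pose Ua := [set f' | U f' /\ translation (piW l w) f' = root1 R N a *: f'].
apply: (IH Ua (h a) _ _ (conj (Uh a) (hh a)) G Gs) => //.
- split; first by split; [exact: UL.1 | rewrite scaler0].
  move=> c u v [Uu hu] [Uv hv]; split; first exact: UL.2.
  by rewrite translation_linear hu hv scalerDr !scalerA mulrC.
- move=> k u [Uu hu]; split; first exact: Ut.
  apply: funext => b; have := congr1 (fun f => f (b + piW l k)) hu.
  by rewrite /translation addrAC => ->.
move=> u [[Uu hu] hws]; apply: GS; split=> // w'.
by rewrite inE => /orP[/eqP->|/hws//]; exists a.
Qed.

Lemma translation_eigenvector_wave (q : 'I_n -> t) (w : 'I_n -> weight g) N f :
  (forall i, coroot_lattice (q i)) ->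
  (forall i j, dot (wval (w i)) (q j) = (i == j)%:R) -> complete q ->
  (forall i, exists a, translation (piW l (w i)) f = root1 R N a *: f) ->
  exists y, f = wave y (f 0) /\ (f 0 != 0 -> Tl l y).
Proof.
move=> qQ wq cq /choice[a ha].
(* The sign compensates the inverse in [wave], so that translation by w_i has eigenvalue
   [root1 R N (a i)]. *)
pose y : T g := expT (- \sum_i (2 * pi * ((a i)%:R / N%:R)) *: q i).
have fE k b : f (b + piW l k) = (chiT k y)^-1 *: f b.
  pose G := [set k | forall b, f (b + piW l k) = (chiT k y)^-1 *: f b].
  have : G k; last by apply.
  apply: (@weights_generated _ _ q w G) => // {k b}.
    split=> [b|k k' hk hk' b].
      by rewrite (_ : piW l 0 = 0) ?addr0 ?chiT0l ?invr1 ?scale1r //; apply/piWE/rpred0.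
    have := hk' (b + piW l (k - k')); rewrite -addrA -piWD subrK hk => h.
    rewrite chiTDl chiTNl invfM invrK mulrC -scalerA h scalerA divff ?scale1r //.
    exact: chiT_neq0.
  move=> i b; have := congr1 (fun f => f b) (ha i); rewrite /translation => ->.
  congr (_ *: _); rewrite chiT_expT dotNr cisN invrK dot_sumr (bigD1 i) //=.
  rewrite big1 => [|j ji]; last by rewrite dotZr wq eq_sym (negbTE ji) mulr0.
  by rewrite dotZr wq eqxx mulr1 addr0.
exists y; split=> [|f0].
  by apply: funext => b; rewrite /wave -fE add0r piW_repr.
apply/TlP => k /piWE k0; have := fE k 0; rewrite k0 addr0 => /eqP.
rewrite -{1}[f 0]scale1r -subr_eq0 -scalerBl scaler_eq0 (negbTE f0) orbF subr_eq0.
by move=> /eqP/esym/(congr1 GRing.inv); rewrite invrK invr1.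
Qed.

Lemma A_eigenspace_waves A x (ts : seq (T g)) (f : WL -> Hs) :
  uniq ts -> (forall z, TA A z <-> z \in ts) -> A_eigenspace A x f ->
  exists v : T g -> Hs, (forall z, Pi_eigenspace (x + z) (v z)) /\
    f = \sum_(z <- ts) wave (x + z) (v z).
Proof.
move=> uts tsE Ff.
have [q [w [qQ wq cq cw]]] := dual_lattice_bases g.
have [N N0 hN] := in_nc_Ra_exponent g l.
(* Sums of such waves form a subgroup, so membership need only be checked on joint eigenvectors of
   the translations. *)
pose G := [set f : WL -> Hs | exists v : T g -> Hs,
  (forall z, Pi_eigenspace (x + z) (v z)) /\ f = \sum_(z <- ts) wave (x + z) (v z)].
have /(_ G) := translation_decomposition (ws := codom w) N0 hN (lin_closed_A_eigenspace A x)
  (@translation_A_eigenspace A x) Ff.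
apply=> {f Ff}; rewrite /G.
  split=> [|f f' [v [hv ->]] [v' [hv' ->]]].
    exists (fun=> 0); split=> [z|]; first exact: (lin_closed_Pi_eigenspace _).1.
    by rewrite big1 // => z _; apply: funext => b; rewrite /wave scaler0.
  exists (fun z => v z - v' z); split=> [z|].
    rewrite -scaleN1r [v z + _]addrC; exact: (lin_closed_Pi_eigenspace _).2.
  by rewrite -sumrB; apply: eq_bigr => z _; apply: funext => b; rewrite /wave scalerBr.
move=> f [Ff fw].
have [|y [fE fT]] := @translation_eigenvector_wave q w N f qQ wq cq.
  by move=> i; apply: fw; exact: codom_f.
(* If f 0 = 0 then f itself is zero, and nothing places y in T_l; otherwise y - x lies in T_A and f
   is the single wave there. *)
have [f0|f0] := eqVneq (f 0) 0.
  exists (fun=> 0); split=> [z|]; first exact: (lin_closed_Pi_eigenspace _).1.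
  rewrite fE f0 big1 => [|z _]; by apply: funext => b; rewrite /wave scaler0.
have yT := fT f0; rewrite fE in Ff; have [vE yx] := wave_A_eigenspaceP yT f0 Ff.
have yts : y - x \in ts.
  by apply/tsE/TAP => k Ak; rewrite chiTDr chiTNr yx // divff ?chiT_neq0.
exists (fun z => if z == y - x then f 0 else 0); split=> [z|].
  case: eqP => [->|_]; first by rewrite addrCA subrr addr0.
  exact: (lin_closed_Pi_eigenspace _).1.
rewrite (bigD1_seq (y - x)) //= eqxx big1 => [|z /negbTE ->].
  by rewrite addr0 {1}fE addrCA subrr addr0.
by apply: funext => b; rewrite /wave scaler0.
Qed.

(** Waves at distinct points have distinct families of eigenvalues under the translations, by
    [chiT_sep]. *)
Lemma waves_free (ts : seq (T g)) (v : T g -> Hs) x : uniq ts ->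
  (forall z, z \in ts -> Tl l (x + z)) -> \sum_(z <- ts) wave (x + z) (v z) = 0 ->
  forall z, z \in ts -> v z = 0.
Proof.
move=> uts tsT sum0 z zts.
have vE : v z = wave (x + z) (v z) (piW l 0).
  by rewrite (wave_piW _ _ (tsT z zts)) chiT0l invr1 scale1r.
have w0 : wave (x + z) (v z) = 0; last by rewrite vE w0.
apply: (@eigen_sum_eq0 R[i] (WL -> Hs) (weight g) (T g)
  (fun k => translation (piW l k)) (fun z k => (chiT k (x + z))^-1) _ _
  (fun z => wave (x + z) (v z)) ts uts _ sum0 z zts).
- by move=> k; exact: translation_linear.
- move=> z1 z2 z12; apply: contrapT => no; apply: z12; apply/eqP.
  rewrite -subr_eq0; apply/eqP/chiT_sep => k.
  rewrite chiTDr chiTNr; have : (chiT k (x + z1))^-1 = (chiT k (x + z2))^-1.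
    by apply: contrapT => h'; apply: no; exists k.
  move/invr_inj; rewrite !chiTDr => /(mulfI (chiT_neq0 k x)) ->.
  by rewrite divff ?chiT_neq0.
- move=> z' z'ts k; apply: funext => a.
  rewrite /translation -(piW_repr a) -piWD !(wave_piW _ _ (tsT z' z'ts)) chiTDl.
  by rewrite scale_funE (wave_piW _ _ (tsT z' z'ts)) invfM mulrC scalerA.
Qed.

End QuantumRootSpace.

(** * Dimension of the A-eigenspace *)

Section Dimension.
Variables (R : realType) (g : simpleDatum R) (l : nat).
Variables (Hs : vectType R[i]) (Pi : (Tl0 g l -> R[i]) -> 'End(Hs)).
Local Notation WL := (Wl g l).
Implicit Types (x y : T g) (A : set WL).

Lemma Tl_shift A x z : A 0 -> Tl l x -> TA A z -> Tl l (x + z).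
Proof.
move=> A0 /TlP xT /TAP zA; apply/TlP => k kR.
by rewrite chiTDr xT // zA ?mulr1 //; have /piWE -> := kR.
Qed.

Lemma waveZ y c (v : Hs) : wave y (c *: v) = c *: wave y v :> (WL -> Hs).
Proof. by apply: funext => a; rewrite scale_funE /wave !scalerA mulrC. Qed.

Lemma wave_sum y (J : Type) (r : seq J) (P : pred J) (v : J -> Hs) :
  wave y (\sum_(j <- r | P j) v j) = \sum_(j <- r | P j) wave y (v j) :> (WL -> Hs).
Proof.
elim/big_rec2: _ => [|j a b _ <-]; apply: funext => c; rewrite /wave ?scaler0 //.
exact: scalerDr.
Qed.

Lemma fdim_A_eigenspace A x (ts : seq (T g)) : A 0 -> Tl l x -> uniq ts ->
  (forall z, TA A z <-> z \in ts) ->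
  fdim (A_eigenspace Pi A x) = (\sum_(z <- ts) fdim (Pi_eigenspace Pi (x + z)))%N.
Proof.
move=> A0 xT uts tsE.
have /choice[V hV] z : exists V : {vspace Hs},
    forall v, Pi_eigenspace Pi (x + z) v <-> v \in V.
  exact/lin_closed_vspace/lin_closed_Pi_eigenspace.
pose z_ (i : 'I_(size ts)) := nth 0 ts i.
pose J := {i : 'I_(size ts) & 'I_(\dim (V (z_ i)))}.
have zts i : z_ i \in ts by rewrite mem_nth.
have ztsA i : TA A (z_ i) by apply/tsE.
pose b (p : J) : WL -> Hs :=
  wave (x + z_ (tag p)) (vbasis (V (z_ (tag p))))`_(tagged p).
have sumE (c : J -> R[i]) : \sum_p c p *: b p =
    \sum_i wave (x + z_ i) (\sum_(j < \dim (V (z_ i)))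
      c (Tagged (fun i => 'I_(\dim (V (z_ i)))) j) *: (vbasis (V (z_ i)))`_j).
  under [RHS]eq_bigr do rewrite wave_sum.
  rewrite sig_big_dep /=; apply: eq_bigr => -[i j] _.
  by rewrite waveZ.
rewrite (@fdim_family _ _ _ J b) //.
- rewrite (big_nth 0) big_mkord -sum1_card.
  rewrite -(sig_big_dep (op := addn) xpredT (fun i => xpredT) (fun i j => 1%N)) /=.
  by apply: eq_bigr => i _; rewrite (fdim_vspace (hV _)) sum1_card card_ord.
- move=> [i j]; apply: wave_A_eigenspace.
  + exact: Tl_shift A0 xT (ztsA i).
  + by apply/hV/vbasis_mem; rewrite mem_nth // size_tuple.
  + by move=> k Ak; rewrite chiTDr; have /TAP/(_ k Ak) -> := ztsA i; rewrite mulr1.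
- move=> f Ff; have [v [vE ->]] := A_eigenspace_waves uts tsE Ff.
  exists (fun p => coord (vbasis (V (z_ (tag p)))) (tagged p) (v (z_ (tag p)))).
  rewrite sumE (big_nth 0) big_mkord; apply: eq_bigr => i _; congr wave.
  exact/coord_vbasis/hV.
- move=> c; rewrite sumE => sum0 [i j].
  (* The amplitude as a function on T, as [waves_free] expects; the value 0 is taken only off
     [ts]. *)
  pose cz z := if insub (index z ts) is Some i then
    \sum_(j < \dim (V (z_ i))) c (Tagged (fun i => 'I_(\dim (V (z_ i)))) j) *: (vbasis (V (z_ i)))`_j
    else 0.
  have czE k : cz (z_ k) = \sum_(j < \dim (V (z_ k)))
      c (Tagged (fun i => 'I_(\dim (V (z_ i)))) j) *: (vbasis (V (z_ k)))`_j.
    by rewrite /cz /z_ index_uniq // valK.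
  have := @waves_free R g l Hs ts cz x uts _ _ (z_ i) (zts i).
  rewrite czE => cz0; have /freeP fr := basis_free (vbasisP (V (z_ i))).
  apply: (fr (fun j => c (Tagged (fun i => 'I_(\dim (V (z_ i)))) j)) _ j).
  apply: cz0 => [z /tsE|]; first exact: Tl_shift.
  by rewrite (big_nth 0) big_mkord -[RHS]sum0; apply: eq_bigr => k _; rewrite -czE.
Qed.

End Dimension.

Theorem theorem8p21 (R : realType) (g : simpleDatum R) (l : nat)
    (Hs : vectType R[i]) (ip : {dot Hs for (@Num.conj R[i])})
    (Pi : (Tl0 g l -> R[i]) -> 'End(Hs)) (hPi : is_USrep ip Pi)
    (A : set (Wl g l)) (hA : is_subgroup A) :
  (forall H : tor g, Tl0 g l (expT H) ->
     mA Pi A (expT H) = \sum_(x \in TA A) mPi Pi (expT H + x)) /\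
  (forall H : tor g, Tl0 g l (expT H) ->
     mA Pi [set: Wl g l] (expT H) = mPi Pi (expT H) /\
     (forall th, weyl th ->
        mPi Pi (expT H) = mA Pi [set: Wl g l] (expT (th H)))).
Proof.
have mAT x : Tl l x -> mA Pi [set: Wl g l] x = mPi Pi x.
  (* The annihilator of the full weight lattice is trivial, so the sum has one term. *)
  move=> xT; have T0 z : TA [set: Wl g l] z <-> z \in [:: 0].
    rewrite inE; split=> [/TAP h|/eqP ->].
      by apply/eqP/chiT_sep => k; exact: h.
    by apply/TAP => k _; exact: chiT0r.
  have := fdim_A_eigenspace Pi I xT (isT : uniq [:: 0]) T0.
  by rewrite big_seq1 addr0.
split=> H [HT _].
  (* A contains the class 0, hence T_A is contained in the finite group T_l. *)
  have finA : finite_set (TA A).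
    apply: (sub_finite_set _ (Tl_finite g l)) => z zA.
    by rewrite -[z]add0r; apply: (Tl_shift hA.1 _ zA); apply/TlP => k _; exact: chiT0r.
  have [ts0 tsE] := (finite_seqP _).1 finA; pose ts := undup ts0.
  have uts : uniq ts by exact: undup_uniq.
  have TAE : TA A = [set` ts].
    by rewrite tsE; apply/seteqP; split=> z /=; rewrite mem_undup.
  rewrite TAE -fsbig_seq //; apply: fdim_A_eigenspace => //; first exact: hA.1.
  by move=> z; rewrite TAE.
split=> [|th hth]; first exact: mAT.
rewrite mAT; last exact: weyl_Tl.
(* Both joint eigenspaces are the same subset of [Hs], since [chi w] takes the same value at e^H and
   at its Weyl translate. *)
congr fdim; apply/seteqP; split=> v /= hv w fw; rewrite hv //.
  by rewrite weyl_chi.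
by rewrite weyl_chi.
Qed.
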